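(* Let $f:C\to E$ be the bielliptic cover described in the context, and let $\nabla_{\mathcal O}=d+\omega$ be a regular connection on the trivial bundle $\mathcal O_C$ with connection form $\omega=\lambda_1\frac{d\xi}{y}+\lambda_2\frac{\xi\,d\xi}{y}$ ($\lambda_1,\lambda_2\in\mathbb C$). Then the direct image $\nabla=f_*(\nabla_{\mathcal O})$ is a logarithmic connection on a rank-$2$ vector bundle $\mathcal E_0$ $(=f_*\mathcal O_C)$ over $E$, whose only poles are the two branch points $p_\pm$ of $f$. In an appropriate trivialization of $\mathcal E_0$ over $E\setminus\{\infty\}$ (namely the basis $(1,\xi)$), $\nabla$ is given by the connection matrix $$A=\begin{pmatrix}-\frac{\lambda_2}{2y}\,dx & -\frac{\lambda_1}{2y}\,dx\\[2pt] -\frac{\lambda_1}{2(t'-x)y}\,dx & -\left(\frac{\lambda_2}{2y}+\frac{1}{2(t'-x)}\right)dx\end{pmatrix},$$ and the residues at $p_\pm$ are $$\operatorname{Res}_{p_+}A=\begin{pmatrix}0&0\\ \frac{\lambda_1}{2y_0}&\frac12\end{pmatrix},\qquad \operatorname{Res}_{p_-}A=\begin{pmatrix}0&0\\ -\frac{\lambda_1}{2y_0}&\frac12\end{pmatrix}.$$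
   Context: Let $t,t'\in\mathbb C\setminus\{0,1\}$, $t\neq t'$. $E$ is the elliptic curve (smooth projective model) $y^2=x(x-1)(x-t)$, with point at infinity $\infty$; $C$ is the genus-$2$ curve (smooth projective model) $y^2=(t'-\xi^2)(t'-1-\xi^2)(t'-t-\xi^2)$; $f:C\to E$ is the degree-$2$ map $(\xi,y)\mapsto(x,y)=(t'-\xi^2,y)$. Let $y_0=\sqrt{t'(t'-1)(t'-t)}$; the branch points of $f$ are $p_\pm=(t',\pm y_0)\in E$. Vector bundles are identified with locally free sheaves. The matrix $(a_{ij})$ of a connection $\nabla$ in a basis $(e_1,e_2)$ is defined by $\nabla(e_j)=\sum_i a_{ij}e_i$. A meromorphic connection is logarithmic if near each singular point its matrix in a local holomorphic frame has at most a simple pole. The direct image of $\nabla_{\mathcal L}:\mathcal L\to\mathcal L\otimes\Omega^1_C$ is the induced meromorphic connection on the sheaf-theoretic direct image $f_*\mathcal L$. *)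

(* Defs.v *)
From HB Require Import structures.
From mathcomp Require Import all_boot all_order all_algebra.
From mathcomp Require Import ring.
From mathcomp Require Import generic_quotient polyXY qpoly qfpoly complex.
From mathcomp Require Import mathcomp_extra boolp classical_sets functions.
From mathcomp Require Import cardinality reals.

Set Implicit Arguments.
Unset Strict Implicit.
Unset Printing Implicit Defensive.

Import Order.TTheory GRing.Theory Num.Theory.

Local Open Scope classical_set_scope.
Local Open Scope ring_scope.

(* Everything is algebraic: a smooth projective curve over [k] is given by its
   closed points and its Zariski local rings, and vector bundles are locally
   free sheaves for the Zariski topology.  All rings live in one ambient field
   [K], the function field of the source of the covering; the function field of
   the target is identified with its image under pull-back. *)

Section DifferentialForms.
Variables (k K : fieldType) (iota : {rmorphism k -> K}).

Record derivation := Derivation {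
  der :> K -> K;
  derD : forall a b, der (a + b) = der a + der b;
  derM : forall a b, der (a * b) = a * der b + b * der a;
  derC : forall c, der (iota c) = 0
}.

(* Meromorphic forms, as functions on rational vector fields.  When K is a
   finitely generated extension of k, Kaehler differentials are the dual of
   derivations, and the functions of the form \sum_i a_i db_i (see [forms])
   are exactly the elements of that dual. *)
Definition form : lmodType K := derivation -> K^o.

Definition d (g : K) : form := fun D => D g.

Definition forms (S : set K) : set form := [set eta |
  exists2 s : seq (K * K), (forall p, p \in s -> S p.1 /\ S p.2) &
    eta = \sum_(p <- s) p.1 *: d p.2].

End DifferentialForms.

Arguments d {k K} iota g.
Arguments forms {k K} iota S.

Section Curves.
Variables (k K : fieldType) (iota : {rmorphism k -> K}).

Definition eval2 (p : {poly {poly k}}) (u v : K) : K :=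
  (map_poly (map_poly iota) p).[u, v].

(* [value_at_chart u v u0 v0 g r]: on the affine curve with coordinate
   functions u, v, the function g is regular at (u0, v0) and takes there the
   value r. *)
Definition value_at_chart (u v : K) (u0 v0 : k) (g : K) (r : k) : Prop :=
  exists a b : {poly {poly k}},
    [/\ b.[u0, v0] != 0, g = eval2 a u v / eval2 b u v
      & r = a.[u0, v0] / b.[u0, v0]].

Definition field_gen (u v : K) : set K :=
  [set g | exists a b : {poly {poly k}},
     eval2 b u v != 0 /\ g = eval2 a u v / eval2 b u v].

Record curve := Curve {
  point :> Type;
  funfield : set K;
  value : point -> K -> k -> Prop
}.

Variable X : curve.
Implicit Types (P : X) (U V : set X) (F : set X -> set K).

(* The nonempty Zariski open subsets: the empty set, over which sections of a
   subsheaf of the constant sheaf K would not be elements of K, is excluded. *)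
Definition zopen U := finite_set (~` U).

Definition stalk P : set K := [set g | exists r, value P g r].

Definition structure_sheaf U : set K := [set g | forall P, U P -> stalk P g].

Definition uniformizer P (z : K) :=
  value P z 0 /\
  forall g, value P g 0 -> exists2 h, stalk P h & g = h * z.

Definition mero_form : set (form iota) := forms iota (funfield X).
Definition regular_form P : set (form iota) := forms iota (stalk P).

Definition simple_pole P (eta : form iota) :=
  mero_form eta /\ exists2 z, uniformizer P z & regular_form P (z *: eta).

Definition has_residue P (eta : form iota) (r : k) :=
  exists z theta, [/\ uniformizer P z, regular_form P theta
    & eta = (iota r / z) *: d iota z + theta].

Definition frame n F U (e : 'I_n -> K) :=
  forall V, zopen V -> V `<=` U ->
    (forall s, F V s <-> exists2 a : 'I_n -> K,
       forall i, structure_sheaf V (a i) & s = \sum_i a i * e i) /\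
    (forall a : 'I_n -> K, (forall i, structure_sheaf V (a i)) ->
       \sum_i a i * e i = 0 -> forall i, a i = 0).

Definition vector_bundle n F :=
  [/\ forall U a s1 s2, zopen U -> structure_sheaf U a -> F U s1 -> F U s2 ->
        F U (a * s1 + s2),
      forall U s, zopen U ->
        (F U s <-> forall P, U P ->
           exists V, [/\ zopen V, V `<=` U, V P & F V s])
    & forall P, exists U (e : 'I_n -> K), [/\ zopen U, U P & frame F U e]].

(* A meromorphic connection is given by its action on the generic stalk.  The
   forms of X act on K through their pull-back, so that K (x) (forms of X) is
   the space of all forms and nabla may take its values there. *)
Implicit Type nabla : K -> form iota.

Definition connection F nabla :=
  forall U, zopen U ->
    (forall s1 s2, F U s1 -> F U s2 -> nabla (s1 + s2) = nabla s1 + nabla s2) /\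
    (forall a s, structure_sheaf U a -> F U s ->
       nabla (a * s) = s *: d iota a + a *: nabla s).

Definition connection_matrix n nabla (e : 'I_n -> K) (A : 'M[form iota]_n) :=
  (forall i j, mero_form (A i j)) /\
  (forall j, nabla (e j) = \sum_i e i *: A i j).

Definition logarithmic n F nabla :=
  connection F nabla /\
  forall P U (e : 'I_n -> K), zopen U -> U P -> frame F U e ->
    exists2 A, connection_matrix nabla e A
             & forall i j, simple_pole P (A i j).

Definition pole n F nabla P :=
  ~ exists U (e : 'I_n -> K) A,
      [/\ zopen U, U P, frame F U e, connection_matrix nabla e A
        & forall i j, regular_form P (A i j)].

End Curves.

Definition direct_image (k K : fieldType) (Y X : curve k K) (f : Y -> X)
    (F : set Y -> set K) : set X -> set K := fun U => F (f @^-1` U).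

(* The direct image of nabla is nabla itself, on sections over f^-1(U), once
   forms on Y are written as K (x) (forms of X). *)
Definition direct_image_connection (k K : fieldType) (iota : {rmorphism k -> K})
    (nabla : K -> form iota) : K -> form iota := nabla.

Section BiellipticCover.
Variable k : numClosedFieldType.

Record moduli := Moduli {
  mod_t : k;
  mod_t' : k;
  t_neq0 : mod_t != 0;
  t_neq1 : mod_t != 1;
  t'_neq0 : mod_t' != 0;
  t'_neq1 : mod_t' != 1;
  t_neq_t' : mod_t != mod_t'
}.

Variable c : moduli.
Local Notation t := (mod_t c).
Local Notation t' := (mod_t' c).
Local Notation "z %:F" := (FracField.tofrac z).

Lemma fraction_rep (R : idomainType) (z : {fraction R}) :
  exists a b : R, b != 0 /\ z * b%:F = a%:F.
Proof.
elim/quotW: z => u; exists \n_u, \d_u; split; first exact: denom_ratioP.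
unlock FracField.tofrac; rewrite -[LHS]FracField.pi_mul; apply/eqmodP => /=.
rewrite FracField.equivfE /FracField.mulf.
by rewrite !numden_Ratio ?(oner_eq0, mulr1, mulf_neq0, denom_ratioP) // mulrC.
Qed.

Definition E_rhs : {poly k} := 'X * ('X - 1) * ('X - t%:P).

Definition C_rhs : {poly k} :=
  (t'%:P - 'X^2) * ((t' - 1)%:P - 'X^2) * ((t' - t)%:P - 'X^2).

Definition C_poly : {poly {fraction {poly k}}} := 'X^2 - (C_rhs%:F)%:P.

Lemma mup_C_rhs (r : k) : r ^+ 2 = t' -> mup r C_rhs = 1%N.
Proof.
move=> r2; pose g : {poly k} :=
  - ('X + r%:P) * ((t' - 1)%:P - 'X^2) * ((t' - t)%:P - 'X^2).
have -> : C_rhs = ('X - r%:P) * g.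
  by rewrite /C_rhs /g -[in t'%:P - _]r2 polyC_exp; ring.
rewrite mupMl; first by rewrite -['X - _]expr1 mup_XsubCX eqxx.
have rN0 : r != 0 by rewrite -sqrf_eq0 r2 t'_neq0.
rewrite /root /g !hornerE r2.
rewrite !mulf_eq0 oppr_eq0 -mulr2n mulrn_eq0 (negPf rN0) /=.
rewrite (_ : t' - 1 - t' = -1); last by ring.
rewrite (_ : t' - t - t' = - t); last by ring.
by rewrite !oppr_eq0 oner_eq0 (negPf (t_neq0 c)).
Qed.

Lemma C_poly_irr : monic_irreducible_poly C_poly.
Proof.
have size_C : size C_poly = 3.
  by rewrite size_polyDl size_polyXn // size_polyN size_polyC; case: (_ != 0).
split; last first.
  rewrite monicE lead_coefDl ?lead_coefXn //.
  by rewrite size_polyXn size_polyN size_polyC; case: (_ != 0).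
apply: cubic_irreducible; first by rewrite size_C.
move=> z; apply/negP; rewrite /root !hornerE subr_eq0 => /eqP z2.
have [r r2] : exists r : k, r ^+ 2 = t' by exists (sqrtC t'); rewrite sqrtCK.
have F0 : C_rhs != 0.
  by apply: contra_eq_neq (mup_C_rhs r2) => ->; rewrite /mup; case: arg_maxnP;
     [rewrite expr0 dvd1p | case=> m; rewrite /= size_poly0; case: m].
have [a [b [b0 za]]] : exists a b : {poly k}, b != 0 /\ z * b%:F = a%:F.
  exact: fraction_rep.
have : a ^+ 2 = C_rhs * b ^+ 2.
  by apply/eqP; rewrite -tofrac_eq (tofracM C_rhs) !tofracXn -za exprMn z2.
move=> e; have a0 : a != 0.
  by rewrite -sqrf_eq0 e mulf_neq0 // sqrf_eq0.
move/(congr1 (fun p => odd (mup r p))): e.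
rewrite !expr2 (mupM r a0 a0) (mupM r F0) ?mulf_neq0 // (mupM r b0 b0).
by rewrite mup_C_rhs // !oddD !addbb.
Qed.

(* k(C) = k(xi)[y] / (y^2 - C_rhs(xi)). *)
Definition kC : fieldType := {poly %/ C_poly with C_poly_irr}.

Definition const : {rmorphism k -> kC} :=
  (qpolyC C_poly \o (@FracField.tofrac _) \o polyC
     : {rmorphism _ -> {poly %/ C_poly}}).
Definition xi : kC := qpolyC C_poly ('X)%:F.
Definition y : kC := qpolyX C_poly.

(* The pull-backs to C of the coordinate functions of E are x and y; the field
   k(E) is the subfield k(x, y) of k(C). *)
Definition x : kC := const t' - xi ^+ 2.

(* [Cinf w] is the point at infinity at which y / xi^3 takes the value w. *)
Inductive C_point :=
| Caff (xi0 y0 : k) of y0 ^+ 2 = C_rhs.[xi0]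
| Cinf (w : k) of w ^+ 2 = -1.

Inductive E_point :=
| Eaff (x0 y0 : k) of y0 ^+ 2 = E_rhs.[x0]
| Einf.

Definition C_value (Q : C_point) : kC -> k -> Prop :=
  match Q with
  | Caff xi0 y0 _ => value_at_chart const xi y xi0 y0
  | Cinf w _ => value_at_chart const xi^-1 (y / xi ^+ 3) 0 w
  end.

(* In the coordinates u = x / y, v = 1 / y, the curve E is
   v = u (u - v) (u - t v), and its point at infinity is u = v = 0. *)
Definition E_value (P : E_point) : kC -> k -> Prop :=
  match P with
  | Eaff x0 y0 _ => value_at_chart const x y x0 y0
  | Einf => value_at_chart const (x / y) y^-1 0 0
  end.

Definition C : curve k kC := Curve (field_gen const xi y) C_value.
Definition E : curve k kC := Curve (field_gen const x y) E_value.

Lemma cover_subproof (xi0 y0 : k) :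
  y0 ^+ 2 = C_rhs.[xi0] -> y0 ^+ 2 = E_rhs.[t' - xi0 ^+ 2].
Proof. by move=> ->; rewrite /C_rhs /E_rhs !hornerE; ring. Qed.

Definition cover (Q : C) : E :=
  match Q with
  | Caff _ _ h => Eaff (cover_subproof h)
  | Cinf _ _ => Einf
  end.

Lemma branch_subproof (y0 : k) :
  y0 ^+ 2 = t' * (t' - 1) * (t' - t) -> y0 ^+ 2 = E_rhs.[t'].
Proof. by move=> ->; rewrite /E_rhs !hornerE. Qed.

Lemma branchN_subproof (y0 : k) :
  y0 ^+ 2 = t' * (t' - 1) * (t' - t) -> (- y0) ^+ 2 = E_rhs.[t'].
Proof. by rewrite sqrrN => /branch_subproof. Qed.

Definition p_plus (y0 : k) (h : y0 ^+ 2 = t' * (t' - 1) * (t' - t)) : E :=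
  Eaff (branch_subproof h).
Definition p_minus (y0 : k) (h : y0 ^+ 2 = t' * (t' - 1) * (t' - t)) : E :=
  Eaff (branchN_subproof h).

Definition omega (lambda1 lambda2 : k) : form const :=
  (const lambda1 / y) *: d const xi + (const lambda2 * xi / y) *: d const xi.

Definition nabla_O (lambda1 lambda2 : k) (s : kC) : form const :=
  d const s + s *: omega lambda1 lambda2.

Definition E0 : set E -> set kC :=
  direct_image cover (structure_sheaf (X := C)).

Definition nabla (lambda1 lambda2 : k) : kC -> form const :=
  direct_image_connection (nabla_O lambda1 lambda2).

Definition basis_1_xi : 'I_2 -> kC := fun i => if i == 0 then 1 else xi.

End BiellipticCover.

Arguments const {k} c.
Arguments xi {k} c.
Arguments y {k} c.
Arguments x {k} c.
Arguments C {k} c.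
Arguments E {k} c.
Arguments Einf {k c}.
Arguments E0 {k} c.
Arguments nabla {k} c lambda1 lambda2 s.
Arguments basis_1_xi {k} c i.

Definition mx2 (T : Type) (a11 a12 a21 a22 : T) : 'M[T]_2 :=
  \matrix_(i, j) if i == 0 then if j == 0 then a11 else a12
                 else if j == 0 then a21 else a22.

(* Main.v *)
(* A section of f_*O_C near P is a function s regular at the two points of C
   over P.  Writing s as a fraction whose denominator vanishes at neither point
   and multiplying by the conjugate under xi |-> - xi puts s in O_P + O_P e, where
   e = xi at the affine points and e = y / xi^3 at infinity; since xi is not in
   k(E), these are local frames.  In them the connection matrices are read off
   from dx = - 2 xi dxi, and dx / y is a regular form on E, so poles can only come
   from the term dx / (2 (t' - x)), at the two points with x = t'.  There every
   regular frame would make 1 / (t' - x) regular: contract the matrix in the basis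
   (1, xi), obtained by a change of frame, with the derivation d/dx, which preserves
   the local rings of the branch points. *)
From mathcomp Require Import all_boot all_order all_algebra.
From mathcomp Require Import ring.
From mathcomp Require Import polyXY qpoly qfpoly.
From mathcomp Require Import boolp functions cardinality.
From mathcomp Require Import complex classical_sets reals.
Require Import Defs.

Set Implicit Arguments.
Unset Strict Implicit.
Unset Printing Implicit Defensive.

Import Order.TTheory GRing.Theory Num.Theory.
Local Open Scope classical_set_scope.
Local Open Scope ring_scope.

(** * Evaluation of bivariate polynomials *)

(** Regularity and values are existential statements about quotients of polynomials in two
    coordinate functions, so a value is well defined only once every polynomial relation between
    these functions is known to hold at every point. On C this comes from the independence of 1 and
    y over k[xi]; on E it is inherited, because each point of E lifts to C and values pull back. The
    entry 1/2 of the residues has one source: for a local generator e with e^2 in k(E), de = e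
    d(e^2) / (2 e^2), half a logarithmic derivative. For e = xi this has a pole where t' - x
    vanishes, while for V = y / xi^3 the function V^2 takes the value -1 at infinity and no pole
    arises. Forms are functions on derivations, so non-regularity is detected by evaluating at an
    actual derivation of k(C). This is why d/dx has to be constructed, by extending a tangent vector
    from the generators xi and y to the whole function field. *)

Section Evaluation.
Variables (k K : fieldType) (iota : {rmorphism k -> K}).
Implicit Types (a b : {poly {poly k}}) (p : {poly k}) (u v : K).

Lemma eval2D a b u v : eval2 iota (a + b) u v = eval2 iota a u v + eval2 iota b u v.
Proof. by rewrite /eval2 rmorphD !hornerD. Qed.

Lemma eval2N a u v : eval2 iota (- a) u v = - eval2 iota a u v.
Proof. by rewrite /eval2 rmorphN !hornerN. Qed.

Lemma eval2B a b u v : eval2 iota (a - b) u v = eval2 iota a u v - eval2 iota b u v.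
Proof. by rewrite eval2D eval2N. Qed.

Lemma eval2M a b u v : eval2 iota (a * b) u v = eval2 iota a u v * eval2 iota b u v.
Proof. by rewrite /eval2 rmorphM !hornerM. Qed.

Lemma eval2_polyC p u v : eval2 iota p%:P u v = (map_poly iota p).[v].
Proof. by rewrite /eval2 map_polyC hornerC. Qed.

Lemma eval2C r u v : eval2 iota r%:P%:P u v = iota r.
Proof. by rewrite eval2_polyC map_polyC hornerC. Qed.

Lemma eval2X u v : eval2 iota 'X u v = u.
Proof. by rewrite /eval2 map_polyX hornerX hornerC. Qed.

Lemma eval2Y u v : eval2 iota 'X%:P u v = v.
Proof. by rewrite eval2_polyC map_polyX hornerX. Qed.

Lemma eval2_map p u v : eval2 iota (map_poly polyC p) u v = (map_poly iota p).[u].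
Proof.
elim/poly_ind: p => [|p r IH]; first by rewrite !rmorph0 /eval2 rmorph0 !horner0.
by rewrite !rmorphD !rmorphM /= !map_polyX !map_polyC /= !hornerE eval2D eval2M
           eval2X eval2C IH.
Qed.

End Evaluation.

Definition eval2E := (eval2D, eval2N, eval2M, eval2C, eval2X, eval2Y, eval2_map).

(** Evaluation along the identity morphism gives values at a point, so the rules for [eval2] serve
    both for functions and for their values. *)
Lemma horner2E (k : fieldType) (b : {poly {poly k}}) (u v : k) :
  b.[u, v] = eval2 idfun b u v.
Proof.
rewrite /eval2; have -> // : map_poly (map_poly idfun) b = b.
by rewrite -[RHS](map_poly_id (g := map_poly idfun)) // => p _; rewrite map_poly_id.
Qed.

Lemma poly2_ind (k : fieldType) (T : {poly {poly k}} -> Prop) :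
  (forall r, T r%:P%:P) ->
  (forall a b, T a -> T b -> T (a + b)) ->
  (forall a, T a -> T (a * 'X)) ->
  (forall a, T a -> T (a * 'X%:P)) ->
  forall a, T a.
Proof.
move=> TC TD TX TY; elim/poly_ind=> [|a p Ta]; first by rewrite -!polyC0.
apply: (TD); first exact: TX.
elim/poly_ind: p => [|p r Tp]; first exact: TC.
by rewrite polyCD polyCM; apply: (TD) => //; apply: TY.
Qed.

(** Remainder of the division by [Y^2 - G]. It depends on [a] alone and not on the field [L], which
    is what carries a relation from functions to values. *)
Lemma eval2_reduce (k : fieldType) (G : {poly k}) (a : {poly {poly k}}) :
  exists a0 a1 : {poly k}, forall (L : fieldType) (j : {rmorphism k -> L}) u v,
    v ^+ 2 = (map_poly j G).[u] ->
    eval2 j a u v = (map_poly j a0).[u] + (map_poly j a1).[u] * v.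
Proof.
elim/poly2_ind: a => [r|a b|a|a].
- exists r%:P, 0 => L j u v _.
  by rewrite eval2C map_polyC rmorph0 hornerC horner0 mul0r addr0.
- case=> a0 [a1 Ea] [b0 [b1 Eb]]; exists (a0 + b0), (a1 + b1) => L j u v h.
  by rewrite eval2D (Ea _ _ _ _ h) (Eb _ _ _ _ h) !rmorphD !hornerD; ring.
- case=> a0 [a1 Ea]; exists (a0 * 'X), (a1 * 'X) => L j u v h.
  by rewrite eval2M eval2X (Ea _ _ _ _ h) !rmorphM /= map_polyX !hornerM !hornerX; ring.
- case=> a0 [a1 Ea]; exists (a1 * G), a0 => L j u v h.
  rewrite eval2M eval2Y (Ea _ _ _ _ h) !rmorphM /= !hornerM -h; ring.
Qed.

(* The relations between u and v are generated by v ^ 2 = G(u) as soon as u is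
   transcendental and v is not a rational function of u. *)
Lemma eval2_eq0 (k K L : fieldType) (iota : {rmorphism k -> K})
    (j : {rmorphism k -> L}) (G : {poly k}) (u v : K) (u0 v0 : L)
    (b : {poly {poly k}}) :
  (forall b0 b1 : {poly k},
     (map_poly iota b0).[u] + (map_poly iota b1).[u] * v = 0 -> b0 = 0 /\ b1 = 0) ->
  v ^+ 2 = (map_poly iota G).[u] -> v0 ^+ 2 = (map_poly j G).[u0] ->
  eval2 iota b u v = 0 -> eval2 j b u0 v0 = 0.
Proof.
move=> free hv hv0; have [b0 [b1 Eb]] := eval2_reduce G b.
rewrite (Eb _ _ _ _ hv) (Eb _ _ _ _ hv0) => /free [-> ->].
by rewrite !rmorph0 !horner0 mul0r addr0.
Qed.

(** [q] has the coefficients of [p] in reverse order, padded to degree [N], so one [N] can clear the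
    denominators of several polynomials in 1/u. The implication [q = 0 -> p = 0] transports
    independence to infinity. *)
Lemma horner_rev (k : fieldType) (p : {poly k}) (N : nat) : (size p <= N.+1)%N ->
  exists2 q : {poly k}, q = 0 -> p = 0 &
    forall (L : fieldType) (j : {rmorphism k -> L}) u, u != 0 ->
      (map_poly j p).[u^-1] * u ^+ N = (map_poly j q).[u].
Proof.
move=> sp; exists (\poly_(i < N.+1) p`_(N - i)) => [q0|L j u u0].
  apply/polyP=> i; rewrite coef0; case: (leqP i N) => iN; last first.
    by rewrite nth_default // (leq_trans sp).
  by move/polyP/(_ (N - i)%N): q0; rewrite coef_poly ltnS leq_subr subKn // coef0.
rewrite (horner_coef_wide _ (n := N.+1)) ?(leq_trans (size_poly _ _)) //.
rewrite [RHS](horner_coef_wide _ (n := N.+1)); last first.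
  by rewrite size_map_poly size_poly.
rewrite mulr_suml (reindex_inj rev_ord_inj) /=; apply: eq_bigr => i _.
rewrite !coef_map coef_poly ltn_ord subSS -mulrA; congr (_ * _).
have iN : (i <= N)%N by rewrite -ltnS.
rewrite -[N in u ^+ N](subnK iN) exprD mulrA exprVn mulVf ?mul1r //.
by rewrite expf_neq0.
Qed.

(** * Values at a point *)

(* val f r means that f is regular at the point, with value r. *)
Definition place (k K : fieldType) (iota : {rmorphism k -> K}) (val : K -> k -> Prop) :=
  [/\ forall r, val (iota r) r,
      forall f g r s, val f r -> val g s -> val (f + g) (r + s),
      forall f g r s, val f r -> val g s -> val (f * g) (r * s),
      forall f r, val f r -> r != 0 -> val f^-1 r^-1
    & forall r, val 0 r -> r = 0].

Section Place.
Variables (k K : fieldType) (iota : {rmorphism k -> K}) (val : K -> k -> Prop).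
Hypothesis pl : place iota val.
Implicit Types (f g : K) (r s : k).

Lemma place_const r : val (iota r) r. Proof. by case: pl. Qed.

Lemma placeD f g r s : val f r -> val g s -> val (f + g) (r + s).
Proof. by case: pl => _ h _ _ _; apply: h. Qed.

Lemma placeM f g r s : val f r -> val g s -> val (f * g) (r * s).
Proof. by case: pl => _ _ h _ _; apply: h. Qed.

Lemma placeV f r : val f r -> r != 0 -> val f^-1 r^-1.
Proof. by case: pl => _ _ _ h _; apply: h. Qed.

Lemma place_eq0 r : val 0 r -> r = 0.
Proof. by case: pl => _ _ _ _; apply. Qed.

Lemma place1 : val 1 1.
Proof. by rewrite -[X in val X _](rmorph1 iota); apply: place_const. Qed.

Lemma place0 : val 0 0.
Proof. by rewrite -[X in val X _](rmorph0 iota); apply: place_const. Qed.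

Lemma placeN f r : val f r -> val (- f) (- r).
Proof.
move=> h; rewrite -mulN1r -[- r]mulN1r; apply: placeM h.
by rewrite -[X in val X _](rmorphN1 iota); apply: place_const.
Qed.

Lemma placeB f g r s : val f r -> val g s -> val (f - g) (r - s).
Proof. by move=> hf hg; apply: placeD => //; apply: placeN. Qed.

Lemma placeX f r n : val f r -> val (f ^+ n) (r ^+ n).
Proof.
by move=> h; elim: n => [|n IH]; rewrite ?expr0 ?exprS; [apply: place1|apply: placeM].
Qed.

Lemma place_fun f r s : val f r -> val f s -> r = s.
Proof.
move=> hr hs; apply/eqP; rewrite -subr_eq0; apply/eqP/place_eq0.
by rewrite -(subrr f); apply: placeB.
Qed.

Lemma place_neq0 f r : val f r -> r != 0 -> f != 0.
Proof. by move=> h; apply: contra_neq => f0; apply: place_eq0; rewrite -f0. Qed.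

Lemma place_eval2 (u v : K) (u0 v0 : k) (a : {poly {poly k}}) :
  val u u0 -> val v v0 -> val (eval2 iota a u v) a.[u0, v0].
Proof.
move=> hu hv; rewrite horner2E; elim/poly2_ind: a => [r|a b ha hb|a ha|a ha].
- by rewrite !eval2C; apply: place_const.
- by rewrite !eval2D; apply: placeD.
- by rewrite !eval2M !eval2X; apply: placeM.
- by rewrite !eval2M !eval2Y; apply: placeM.
Qed.

(** Functions regular at the point form a ring in which nonzero values are invertible, so comparing
    two charts reduces to the values of two coordinate functions. *)
Lemma place_chart (u v : K) (u0 v0 : k) g r :
  val u u0 -> val v v0 -> value_at_chart iota u v u0 v0 g r -> val g r.
Proof.
move=> hu hv [a [b [b0 -> ->]]].
by apply: placeM; [apply: place_eval2|apply: placeV => //; apply: place_eval2].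
Qed.

End Place.

Section ChartPlace.
Variables (k K : fieldType) (iota : {rmorphism k -> K}) (u v : K) (u0 v0 : k).

Lemma chart_eval2 a : value_at_chart iota u v u0 v0 (eval2 iota a u v) a.[u0, v0].
Proof.
exists a, 1; rewrite horner2E -[1]/(1%:P%:P) !eval2C !rmorph1 !divr1.
by rewrite oner_neq0 horner2E.
Qed.

Lemma chart_fst : value_at_chart iota u v u0 v0 u u0.
Proof. by move: (chart_eval2 'X); rewrite horner2E !eval2X. Qed.

Lemma chart_snd : value_at_chart iota u v u0 v0 v v0.
Proof. by move: (chart_eval2 'X%:P); rewrite horner2E !eval2Y. Qed.

Hypothesis nonvanishing : forall b, eval2 iota b u v = 0 -> b.[u0, v0] = 0.

Lemma chart_place : place iota (value_at_chart iota u v u0 v0).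
Proof.
have nv b : b.[u0, v0] != 0 -> eval2 iota b u v != 0.
  by apply: contra_neq => /nonvanishing.
split.
- by move=> r; rewrite -(eval2C iota r u v) -[X in _ X](eval2C idfun r u0 v0) -horner2E;
     apply: chart_eval2.
- move=> f g r s [a [b [b0 -> ->]]] [a' [b' [b'0 -> ->]]].
  exists (a * b' + a' * b), (b * b').
  rewrite !horner2E !eval2E -!horner2E mulf_neq0 // !addf_div //; exact: nv.
- move=> f g r s [a [b [b0 -> ->]]] [a' [b' [b'0 -> ->]]].
  exists (a * a'), (b * b').
  by rewrite !horner2E !eval2E -!horner2E mulf_neq0 // !mulf_div.
- move=> f r [a [b [b0 -> ->]]]; rewrite mulf_eq0 invr_eq0 negb_or => /andP[a0 _].
  by exists b, a; rewrite !invf_div.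
- move=> r [a [b [b0 /esym/eqP + ->]]].
  rewrite mulf_eq0 invr_eq0 (negPf (nv _ b0)) orbF => /eqP/nonvanishing ->.
  by rewrite mul0r.
Qed.

End ChartPlace.

(** * The function field of C *)

Lemma horner_rmorph_polyC (k K : fieldType) (phi : {rmorphism {poly k} -> K}) p :
  (map_poly (phi \o polyC) p).[phi 'X] = phi p.
Proof.
elim/poly_ind: p => [|p r IH]; first by rewrite !rmorph0 horner0.
by rewrite !rmorphD !rmorphM /= map_polyX map_polyC !hornerE IH.
Qed.

Lemma coef_lin_poly (F : fieldType) (a b : F) i :
  (a%:P + b%:P * 'X)`_i = if i is i'.+1 then if i' is 0 then b else 0 else a.
Proof.
rewrite coefD coefC coefCM coefX.
by case: i => [|[|i]] /=; rewrite ?mulr0 ?mulr1 ?addr0 ?add0r.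
Qed.

Lemma lin_poly_eq0 (F : fieldType) (a b : F) :
  a%:P + b%:P * 'X = 0 :> {poly F} -> a = 0 /\ b = 0.
Proof.
move=> /polyP e; split.
  by move: (e 0%N); rewrite coef_lin_poly coef0.
by move: (e 1%N); rewrite coef_lin_poly coef0.
Qed.

Lemma size_lin_poly (F : fieldType) (a b : F) :
  (size (a%:P + b%:P * 'X)%R < 3)%N.
Proof.
rewrite (leq_ltn_trans (size_polyD _ _)) // gtn_max; apply/andP; split.
  by rewrite size_polyC; case: (_ != 0).
rewrite mul_polyC (leq_ltn_trans (size_scale_leq _ _)) //.
by rewrite size_polyX.
Qed.

Lemma frac_lin (K : fieldType) (a1 a2 b1 b2 v : K) : a2 != 0 -> b2 != 0 ->
  a1 / a2 + b1 / b2 * v = (a1 * b2 + b1 * v * a2) / (a2 * b2).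
Proof. by move=> a20 b20; field; rewrite ?a20 ?b20. Qed.

Section FunctionField.
Variables (k : numClosedFieldType) (c : moduli k).
Local Notation iota := (const c).
Local Notation xi := (xi c).
Local Notation y := (y c).
Local Notation x := (x c).
Local Notation "z %:F" := (FracField.tofrac z).

Lemma horner_const_xi (p : {poly k}) :
  (map_poly iota p).[xi] = qpolyC (C_poly c) p%:F.
Proof.
exact: (horner_rmorph_polyC (qpolyC (C_poly c) \o @FracField.tofrac _
          : {rmorphism {poly k} -> kC c})).
Qed.

Lemma size_C_poly : size (C_poly c) = 3.
Proof.
by rewrite size_polyDl size_polyXn // size_polyN size_polyC; case: (_ != 0).
Qed.

Lemma C_polyK : mk_monic (C_poly c) = C_poly c.
Proof. by rewrite /mk_monic size_C_poly; case: (C_poly_irr c) => _ ->. Qed.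

Lemma qpolyC_in (z : {fraction {poly k}}) :
  qpolyC (C_poly c) z = in_qpoly (C_poly c) z%:P.
Proof.
apply: val_inj; rewrite [LHS]/= [RHS]in_qpoly_small // C_polyK size_C_poly size_polyC.
by case: (_ != 0).
Qed.

Lemma kC_decomp (a b : {fraction {poly k}}) :
  (qpolyC (C_poly c) a + qpolyC (C_poly c) b * y : kC c)
    = in_qpoly (C_poly c) (a%:P + b%:P * 'X).
Proof. by rewrite (qpolyC_in a) (qpolyC_in b) in_qpolyD in_qpolyM. Qed.

Lemma lt_size_lin_poly (a b : {fraction {poly k}}) :
  (size (a%:P + b%:P * 'X)%R < size (mk_monic (C_poly c)))%N.
Proof. by rewrite C_polyK size_C_poly size_lin_poly. Qed.

(** Remainders modulo the quadratic [C_poly] are unique, so 1 and y are independent over k(xi).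
    Polynomial coefficients are the form in which relations between coordinate functions arise. *)
Lemma y_free (b0 b1 : {poly k}) :
  (map_poly iota b0).[xi] + (map_poly iota b1).[xi] * y = 0 -> b0 = 0 /\ b1 = 0.
Proof.
rewrite !horner_const_xi kC_decomp => /(congr1 (@polyn _ _)).
rewrite in_qpoly_small; last exact: lt_size_lin_poly.
by move=> /lin_poly_eq0[a0 b0']; split; apply/eqP; rewrite -tofrac_eq0 ?a0 ?b0'.
Qed.

Lemma y_sqr : y ^+ 2 = (map_poly iota (C_rhs c)).[xi].
Proof.
rewrite horner_const_xi.
have -> : y ^+ 2 = in_qpoly (C_poly c) ('X ^+ 2) :> kC c by rewrite rmorphXn.
rewrite -[X in in_qpoly _ X](subrK ((C_rhs c)%:F)%:P) in_qpolyD -qpolyC_in.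
rewrite (_ : in_qpoly _ _ = 0) ?add0r //.
by apply: val_inj; rewrite /= C_polyK Pdiv.RingMonic.rmodpp ?(C_poly_irr c).2.
Qed.

(** A remainder modulo [C_poly] has degree at most 1 in y, and its two coefficients are fractions in
    xi. This is what allows a derivation to be defined on all of k(C) from its values at xi and
    y. *)
Lemma kC_gen (s : kC c) : field_gen iota xi y s.
Proof.
have [a [b]] : exists a b : {fraction {poly k}},
    s = qpolyC (C_poly c) a + qpolyC (C_poly c) b * y.
  have ss : (size (val s) <= 2)%N.
    have sC : (size (mk_monic (C_poly c)) <= 3)%N by rewrite C_polyK size_C_poly.
    rewrite -ltnS; apply: leq_trans sC.
    exact: (size_mk_monic (s : {poly %/ C_poly c})).
  exists (val s)`_0, (val s)`_1; rewrite kC_decomp.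
  apply: val_inj; rewrite [LHS]/= [RHS]in_qpoly_small; last exact: lt_size_lin_poly.
  apply/polyP=> i; rewrite coef_lin_poly; case: i => [|[|i]] //.
  by rewrite nth_default // (leq_trans ss).
have [a1 [a2 [a20 ea]]] := fraction_rep a.
have [b1 [b2 [b20 eb]]] := fraction_rep b.
have nz (p : {poly k}) : p != 0 -> (map_poly iota p).[xi] != 0.
  apply: contra_neq => e; apply: (y_free (b1 := 0) _).1.
  by rewrite rmorph0 horner0 mul0r addr0.
have q (z : {fraction {poly k}}) (p1 p2 : {poly k}) : p2 != 0 -> z * p2%:F = p1%:F ->
    (qpolyC (C_poly c) z : kC c) = (map_poly iota p1).[xi] / (map_poly iota p2).[xi].
  move=> p20 e; apply: (canRL (mulfK (nz _ p20))).
  by rewrite !horner_const_xi -e rmorphM.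
rewrite (q _ _ _ a20 ea) (q _ _ _ b20 eb) => ->.
exists (map_poly polyC a1 * map_poly polyC b2 +
        map_poly polyC b1 * 'X%:P * map_poly polyC a2).
exists (map_poly polyC a2 * map_poly polyC b2).
rewrite !eval2E mulf_neq0 ?nz //; split=> //.
by apply: frac_lin; exact: nz.
Qed.
End FunctionField.

(* U^6 C_rhs(1/U), so that (U, V) = (1/xi, y/xi^3) satisfy V^2 = C_rhs_inf(U). *)
Definition C_rhs_inf (k : numClosedFieldType) (c : moduli k) : {poly k} :=
  (mod_t' c *: 'X^2 - 1) * ((mod_t' c - 1) *: 'X^2 - 1) *
  ((mod_t' c - mod_t c) *: 'X^2 - 1).

Section Evaluations.
Variables (k : numClosedFieldType) (c : moduli k) (L : fieldType).
Variable j : {rmorphism k -> L}.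
Local Notation t := (mod_t c).
Local Notation t' := (mod_t' c).

Lemma map_C_rhs (u : L) : (map_poly j (C_rhs c)).[u] =
  (j t' - u ^+ 2) * (j (t' - 1) - u ^+ 2) * (j (t' - t) - u ^+ 2).
Proof.
have e (a : k) : (map_poly j (a%:P - 'X^2)).[u] = j a - u ^+ 2.
  by rewrite rmorphB /= map_polyXn map_polyC hornerD hornerN hornerC hornerXn.
by rewrite /C_rhs !rmorphM /= !hornerM !e.
Qed.

Lemma map_C_rhs_inf (u : L) : (map_poly j (C_rhs_inf c)).[u] =
  (j t' * u ^+ 2 - 1) * (j (t' - 1) * u ^+ 2 - 1) * (j (t' - t) * u ^+ 2 - 1).
Proof.
have e (a : k) : (map_poly j (a *: 'X^2 - 1)).[u] = j a * u ^+ 2 - 1.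
  by rewrite rmorphB rmorph1 /= map_polyZ map_polyXn hornerD hornerN hornerZ
             hornerC hornerXn.
by rewrite /C_rhs_inf !rmorphM /= !hornerM !e.
Qed.

Lemma inf_identity (z a b d : L) : z != 0 ->
  (a - z ^+ 2) * (b - z ^+ 2) * (d - z ^+ 2) / (z ^+ 3) ^+ 2 =
  (a * z^-1 ^+ 2 - 1) * (b * z^-1 ^+ 2 - 1) * (d * z^-1 ^+ 2 - 1).
Proof. by move=> z0; field. Qed.

Lemma x_over_y_identity (a z v : L) : z != 0 -> v != 0 ->
  (a - z ^+ 2) / v = (a * z^-1 ^+ 2 - 1) * z^-1 / (v / z ^+ 3).
Proof. by move=> z0 v0; field; rewrite z0 v0. Qed.

Lemma inv_y_identity (z v : L) : z != 0 -> v != 0 ->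
  v^-1 = z^-1 ^+ 3 / (v / z ^+ 3).
Proof. by move=> z0 v0; field; rewrite z0 v0. Qed.

Lemma clear_identity (z v A B : L) N : z != 0 ->
  A + B * (v / z ^+ 3) = 0 -> A * z ^+ N * z ^+ 3 + B * z ^+ N * v = 0.
Proof.
move=> z0 e.
have -> : A * z ^+ N * z ^+ 3 + B * z ^+ N * v
     = (A + B * (v / z ^+ 3)) * z ^+ N * z ^+ 3 by field.
by rewrite e !mul0r.
Qed.
End Evaluations.

(** * Places of C and E, and pull-back of values along the cover *)

Section Places.
Variables (k : numClosedFieldType) (c : moduli k).
Local Notation t := (mod_t c).
Local Notation t' := (mod_t' c).
Local Notation iota := (const c).
Local Notation xi := (xi c).
Local Notation y := (y c).
Local Notation x := (x c).

Lemma xi_transcendental (p : {poly k}) : (map_poly iota p).[xi] = 0 -> p = 0.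
Proof.
move=> e; apply: (y_free (c := c) (b1 := 0) _).1.
by rewrite rmorph0 horner0 mul0r addr0.
Qed.

Lemma xi_neq0 : xi != 0.
Proof.
apply/eqP=> e; have := @xi_transcendental 'X.
by rewrite map_polyX hornerX => /(_ e)/eqP; rewrite polyX_eq0.
Qed.

Lemma y_neq0 : y != 0.
Proof.
apply/eqP=> e; have [|_ /eqP] := @y_free _ c 0 1.
  by rewrite rmorph0 horner0 e mulr0 addr0.
by rewrite oner_eq0.
Qed.

Lemma y_sqr_xi :
  y ^+ 2 = (iota t' - xi ^+ 2) * (iota (t' - 1) - xi ^+ 2) * (iota (t' - t) - xi ^+ 2).
Proof. by rewrite y_sqr map_C_rhs. Qed.

Lemma y_sqr_x : y ^+ 2 = x * (x - 1) * (x - iota t).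
Proof. by rewrite y_sqr_xi /x !(rmorphB iota) (rmorph1 iota); ring. Qed.

Lemma y_sqr_inf : (y / xi ^+ 3) ^+ 2 = (map_poly iota (C_rhs_inf c)).[xi^-1].
Proof.
rewrite expr_div_n y_sqr_xi map_C_rhs_inf; apply: inf_identity; exact: xi_neq0.
Qed.

Lemma Caff_place (xi0 y0 : k) : y0 ^+ 2 = (C_rhs c).[xi0] ->
  place iota (value_at_chart iota xi y xi0 y0).
Proof.
move=> h; apply: chart_place => b; rewrite horner2E; apply: (eval2_eq0 (G := C_rhs c)).
- exact: y_free.
- exact: y_sqr.
- by rewrite map_poly_id.
Qed.

(** Multiplication by xi^(N + 3) turns a relation between 1/xi and y / xi^3 into one between xi and
    y, where [y_free] applies; the factor ['X^3] on [q0] compensates the denominator of y / xi^3. *)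
Lemma y_free_inf (b0 b1 : {poly k}) :
  (map_poly iota b0).[xi^-1] + (map_poly iota b1).[xi^-1] * (y / xi ^+ 3) = 0 ->
  b0 = 0 /\ b1 = 0.
Proof.
pose N := maxn (size b0) (size b1).
have [|q0 q00 e0] := @horner_rev _ b0 N; first by rewrite leqW ?leq_maxl.
have [|q1 q10 e1] := @horner_rev _ b1 N; first by rewrite leqW ?leq_maxr.
move=> e; have [|/eqP + /q10 ->] := @y_free _ c (q0 * 'X^3) q1.
  rewrite rmorphM /= map_polyXn hornerM hornerXn -(e0 _ _ _ xi_neq0).
  rewrite -(e1 _ _ _ xi_neq0).
  exact: clear_identity xi_neq0 e.
by rewrite mulf_eq0 expf_eq0 polyX_eq0 andbF orbF => /eqP/q00 ->.
Qed.

Lemma Cinf_place (w : k) : w ^+ 2 = -1 ->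
  place iota (value_at_chart iota xi^-1 (y / xi ^+ 3) 0 w).
Proof.
move=> h; apply: chart_place => b; rewrite horner2E.
apply: (eval2_eq0 (G := C_rhs_inf c)).
- exact: y_free_inf.
- exact: y_sqr_inf.
- rewrite map_poly_id // h /C_rhs_inf !hornerE /=; ring.
Qed.

Lemma C_place (Q : C c) : place iota (value Q).
Proof. by case: Q => [xi0 y0 h|w h]; [apply: Caff_place|apply: Cinf_place]. Qed.

Lemma x_over_y : x / y = (iota t' * xi^-1 ^+ 2 - 1) * xi^-1 / (y / xi ^+ 3).
Proof. exact: x_over_y_identity xi_neq0 y_neq0. Qed.

Lemma inv_y : y^-1 = xi^-1 ^+ 3 / (y / xi ^+ 3).
Proof. exact: inv_y_identity xi_neq0 y_neq0. Qed.

(** Only the coordinate functions of E have to be computed at Q. At infinity they are written in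
    1/xi and y / xi^3, and division by the latter is allowed because its value w is nonzero. *)
Lemma C_value_cover (Q : C c) (g : kC c) (r : k) :
  value (cover Q : E c) g r -> value Q g r.
Proof.
case: Q => [xi0 y0 h|w h].
  have pQ := Caff_place h.
  have vx := chart_fst iota xi y xi0 y0; have vy := chart_snd iota xi y xi0 y0.
  apply: (place_chart pQ) => //.
  exact (placeB pQ (place_const pQ t') (placeX pQ 2 vx)).
have pQ := Cinf_place h.
have vu := chart_fst iota xi^-1 (y / xi ^+ 3) 0 w.
have vv := chart_snd iota xi^-1 (y / xi ^+ 3) 0 w.
have w0 : w != 0 by rewrite -sqrf_eq0 h oppr_eq0 oner_eq0.
apply: (place_chart pQ) => //.
  have h1 := placeB pQ (placeM pQ (place_const pQ t') (placeX pQ 2 vu)) (place1 pQ).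
  rewrite x_over_y; have := placeM pQ (placeM pQ h1 vu) (placeV pQ vv w0).
  by rewrite mulr0 mul0r.
rewrite inv_y; have := placeM pQ (placeX pQ 3 vu) (placeV pQ vv w0).
by rewrite expr0n mul0r.
Qed.

Lemma Eaff_eq (x0 y0 x1 y1 : k) h h' : x0 = x1 -> y0 = y1 ->
  @Eaff _ c x0 y0 h = @Eaff _ c x1 y1 h'.
Proof. by move=> e e'; subst x1 y1; congr Eaff; apply: eq_irrelevance. Qed.

Lemma C_rhs_cover (x0 y0 z : k) : y0 ^+ 2 = (E_rhs c).[x0] -> z ^+ 2 = t' - x0 ->
  y0 ^+ 2 = (C_rhs c).[z].
Proof.
move=> -> hz; rewrite /C_rhs /E_rhs !hornerE /= hz; ring.
Qed.

Lemma cover_surj (P : E c) : exists Q : C c, cover Q = P.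
Proof.
case: P => [x0 y0 h|]; last by exists (Cinf c (sqrCi _)).
exists (Caff (C_rhs_cover h (sqrtCK _))).
by apply: Eaff_eq => //; rewrite sqrtCK subKr.
Qed.

(** A polynomial that vanishes as a function of x and y also vanishes at P, because its value can be
    computed at a point of C above P, where values are already unique. *)
Lemma E_place (P : E c) : place iota (value P).
Proof.
have [Q <-] := cover_surj P; have pQ := C_place Q.
case: Q pQ (@C_value_cover Q) => [xi0 y0 h|w h] pQ vQ; apply: chart_place => b.
all: by move=> b0; apply: (place_eq0 pQ); rewrite -b0; apply: vQ; apply: chart_eval2.
Qed.
End Places.

(** * The fibres of the cover and local frames *)

Section Fiber.
Variables (k K : fieldType) (iota : {rmorphism k -> K}).
Variables (O : K -> k -> Prop) (e : K) (w : k).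
Hypotheses (pO : place iota O) (e_sqr : O (e ^+ 2) (w ^+ 2)).

(* z = f + g e takes the values z1 and z2 at the two points of the fibre, where
   e takes the values w and - w. *)
Definition fiber_value (z : K) (z1 z2 : k) := exists f g r s,
  [/\ O f r, O g s, z = f + g * e, z1 = r + s * w & z2 = r - s * w].

Lemma fiber_valueD z z1 z2 z' z1' z2' :
  fiber_value z z1 z2 -> fiber_value z' z1' z2' ->
  fiber_value (z + z') (z1 + z1') (z2 + z2').
Proof.
case=> f [g [r [s [hf hg -> -> ->]]]] [f' [g' [r' [s' [hf' hg' -> -> ->]]]]].
exists (f + f'), (g + g'), (r + r'), (s + s'); split; try (by apply: (placeD pO)); ring.
Qed.

Lemma fiber_valueM z z1 z2 z' z1' z2' :
  fiber_value z z1 z2 -> fiber_value z' z1' z2' ->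
  fiber_value (z * z') (z1 * z1') (z2 * z2').
Proof.
case=> f [g [r [s [hf hg -> -> ->]]]] [f' [g' [r' [s' [hf' hg' -> -> ->]]]]].
exists (f * f' + g * g' * e ^+ 2), (f * g' + g * f').
exists (r * r' + s * s' * w ^+ 2), (r * s' + s * r').
split; [|by apply: (placeD pO); apply: (placeM pO)| | |]; try ring.
by apply: (placeD pO); apply: (placeM pO) => //; apply: (placeM pO).
Qed.

Lemma fiber_value_base f r : O f r -> fiber_value f r r.
Proof.
move=> h; exists f, 0, r, 0; split; rewrite ?mul0r ?addr0 ?subr0 //.
exact: (place0 pO).
Qed.

Lemma fiber_value_gen : fiber_value e w (- w).
Proof.
exists 0, 1, 0, 1; split; rewrite ?mul1r ?add0r //; first exact: (place0 pO).
exact: (place1 pO).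
Qed.

Variables (u v : K) (u1 v1 u2 v2 : k).
Hypotheses (fu : fiber_value u u1 u2) (fv : fiber_value v v1 v2).

Lemma fiber_value_eval2 (a : {poly {poly k}}) :
  fiber_value (eval2 iota a u v) a.[u1, v1] a.[u2, v2].
Proof.
rewrite !horner2E; elim/poly2_ind: a => [r|a b ha hb|a ha|a ha].
- by rewrite !eval2C; apply: fiber_value_base; apply: (place_const pO).
- by rewrite !eval2D; apply: fiber_valueD.
- by rewrite !eval2M !eval2X; apply: fiber_valueM.
- by rewrite !eval2M !eval2Y; apply: fiber_valueM.
Qed.

(* If s = a1/b1 = a2/b2 with b_i nonzero at the i-th point, one of b1, b2 and
   b1 + b2 is a denominator of s that is nonzero at both. *)
Lemma chart_common_denominator (s : K) r1 r2 :
  (forall b, eval2 iota b u v = 0 -> b.[u1, v1] = 0) ->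
  value_at_chart iota u v u1 v1 s r1 -> value_at_chart iota u v u2 v2 s r2 ->
  exists a b, [/\ b.[u1, v1] != 0, b.[u2, v2] != 0
    & s * eval2 iota b u v = eval2 iota a u v].
Proof.
move=> nv [a1 [b1 [b10 s1 _]]] [a2 [b2 [b20 s2 _]]].
have e1 : s * eval2 iota b1 u v = eval2 iota a1 u v.
  by rewrite s1 divfK //; apply: contra_neq b10 => /nv.
have [b21|b21] := eqVneq b1.[u2, v2] 0; last by exists a1, b1.
(* The hypothesis on vanishing concerns the first point only. If [b2] is zero as a function, then s
   = a2/0 = 0 by the convention on inverses, and 1 is a denominator. *)
have [n2|n2] := eqVneq (eval2 iota b2 u v) 0.
  have s0 : s = 0 by rewrite s2 n2 invr0 mulr0.
  exists 0, 1; rewrite s0 mul0r -(polyC0 _) eval2_polyC rmorph0 horner0.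
  by rewrite !horner2E -[1]/(1%:P%:P) !eval2C !rmorph1 oner_neq0.
have e2 : s * eval2 iota b2 u v = eval2 iota a2 u v by rewrite s2 divfK.
have [b12|b12] := eqVneq b2.[u1, v1] 0; last by exists a2, b2.
exists (a1 + a2), (b1 + b2); rewrite !hornerD b21 b12 addr0 add0r; split=> //.
by rewrite !eval2D mulrDr e1 e2.
Qed.

Lemma fiber_decomp (s : K) :
  (forall b, eval2 iota b u v = 0 -> b.[u1, v1] = 0) ->
  (exists r, value_at_chart iota u v u1 v1 s r) ->
  (exists r, value_at_chart iota u v u2 v2 s r) ->
  exists f g, [/\ exists r, O f r, exists r, O g r & s = f + g * e].
Proof.
move=> nv [r1 s1] [r2 s2].
have [a [b [b1 b2 sba]]] := chart_common_denominator nv s1 s2.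
have B0 : eval2 iota b u v != 0 by apply: contra_neq b1 => /nv.
have [f [g [r [q [hf hg eB q1 q2]]]]] := fiber_value_eval2 b.
have [f' [g' [r' [q' [hf' hg' eA _ _]]]]] := fiber_value_eval2 a.
(* Norm of the denominator under e |-> - e: its value is the product of the two values of the
   denominator in the fibre, so it is a unit at the point below. *)
pose N := f ^+ 2 - g ^+ 2 * e ^+ 2.
have ON : O N ((r + q * w) * (r - q * w)).
  rewrite (_ : _ * _ = r ^+ 2 - q ^+ 2 * w ^+ 2); last by ring.
  apply: (placeB pO); first exact: (placeX pO).
  by apply: (placeM pO) => //; apply: (placeX pO).
have n0 : (r + q * w) * (r - q * w) != 0 by rewrite -q1 -q2 mulf_neq0.
have N0 := place_neq0 pO ON n0; have OVN := placeV pO ON n0.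
exists ((f' * f - g' * g * e ^+ 2) / N), ((g' * f - f' * g) / N); split.
- eexists; apply: (placeM pO) OVN; apply: (placeB pO); first exact: (placeM pO hf' hf).
  exact: (placeM pO (placeM pO hg' hg) e_sqr).
- eexists; apply: (placeM pO) OVN; apply: (placeB pO); first exact: (placeM pO hg' hf).
  exact: (placeM pO hf' hg).
- by apply: (mulIf B0); rewrite sba eA eB /N; field; rewrite exprMn.
Qed.
End Fiber.

(** The substitution x = t' - xi^2 makes polynomials in x, y into polynomials in xi, y that are even
    in xi, ready for conjugation. *)
Lemma eval2_shift (k : fieldType) (t' : k) (a : {poly {poly k}}) :
  exists b : {poly {poly k}}, forall (L : fieldType) (j : {rmorphism k -> L}) u v,
    eval2 j b u v = eval2 j a (j t' - u ^+ 2) v.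
Proof.
elim/poly2_ind: a => [r|a b [a' ha] [b' hb]|a [a' ha]|a [a' ha]].
- by exists r%:P%:P => L j u v; rewrite !eval2C.
- by exists (a' + b') => L j u v; rewrite !eval2D ha hb.
- exists (a' * (t'%:P%:P - 'X * 'X)) => L j u v.
  by rewrite !(eval2M, eval2B) !eval2X eval2C ha expr2.
- by exists (a' * 'X%:P) => L j u v; rewrite !eval2M !eval2Y ha.
Qed.

Section FieldGen.
Variables (k K : fieldType) (iota : {rmorphism k -> K}) (u v : K).
Local Notation F := (field_gen iota u v).

Lemma field_genC r : F (iota r).
Proof.
exists r%:P%:P, 1; rewrite -[1]/(1%:P%:P) !eval2C rmorph1 divr1.
by rewrite oner_neq0.
Qed.

Lemma field_genD f g : F f -> F g -> F (f + g).
Proof.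
case=> a [b [b0 ->]] [a' [b' [b'0 ->]]]; exists (a * b' + a' * b), (b * b').
by rewrite !eval2E mulf_neq0 // addf_div.
Qed.

Lemma field_genM f g : F f -> F g -> F (f * g).
Proof.
case=> a [b [b0 ->]] [a' [b' [b'0 ->]]]; exists (a * a'), (b * b').
by rewrite !eval2E mulf_neq0 // mulf_div.
Qed.

Lemma field_genV f : F f -> F f^-1.
Proof.
case=> a [b [b0 ->]]; have [->|a0] := eqVneq (eval2 iota a u v) 0.
  by rewrite mul0r invr0 -(rmorph0 iota); apply: field_genC.
by exists b, a; rewrite invf_div.
Qed.

Lemma field_gen0 : F 0. Proof. by rewrite -(rmorph0 iota); apply: field_genC. Qed.
Lemma field_gen1 : F 1. Proof. by rewrite -(rmorph1 iota); apply: field_genC. Qed.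

Lemma field_genN f : F f -> F (- f).
Proof.
move=> h; rewrite -mulN1r -(rmorphN1 iota); apply: field_genM => //.
exact: field_genC.
Qed.

Lemma field_gen_fst : F u.
Proof.
by exists 'X, 1; rewrite -[1]/(1%:P%:P) !eval2E rmorph1 divr1 oner_neq0.
Qed.

Lemma field_gen_snd : F v.
Proof.
by exists 'X%:P, 1; rewrite -[1]/(1%:P%:P) !eval2E rmorph1 divr1 oner_neq0.
Qed.

Lemma field_gen_eval2 a f g : F f -> F g -> F (eval2 iota a f g).
Proof.
move=> hf hg; elim/poly2_ind: a => [r|a b ha hb|a ha|a ha]; rewrite !eval2E.
- exact: field_genC.
- exact: field_genD.
- exact: field_genM.
- exact: field_genM.
Qed.

Lemma field_gen_chart f g f0 g0 h r :
  F f -> F g -> value_at_chart iota f g f0 g0 h r -> F h.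
Proof.
move=> hf hg [a [b [_ -> _]]]; apply: field_genM; first exact: field_gen_eval2.
by apply: field_genV; apply: field_gen_eval2.
Qed.
End FieldGen.

(** With u = X/Y and v = 1/Y, the equation v = u (u - v) (u - t v) reads v (1 + (1 + t) u^2 - t u v)
    = u^3, and 1/X = v/u. The denominator takes the value 1 at u = v = 0. *)
Lemma inv_x_identity (L : fieldType) (X Y t : L) : X != 0 -> Y != 0 ->
  Y ^+ 2 = X * (X - 1) * (X - t) ->
  X^-1 = (X / Y) ^+ 2 / (1 + (1 + t) * (X / Y) ^+ 2 - t * (X / Y) * Y^-1).
Proof.
move=> X0 Y0 e.
have -> : 1 + (1 + t) * (X / Y) ^+ 2 - t * (X / Y) * Y^-1
    = (Y ^+ 2 + (1 + t) * X ^+ 2 - t * X) / Y ^+ 2 by field.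
have -> : Y ^+ 2 + (1 + t) * X ^+ 2 - t * X = X ^+ 3 by rewrite e; ring.
by field; rewrite X0 Y0.
Qed.

Lemma y_over_xi3_identity (L : fieldType) (X Y t a : L) : X != 0 -> a - X != 0 ->
  Y ^+ 2 = X * (X - 1) * (X - t) ->
  Y ^+ 2 / (a - X) ^+ 3 =
  (1 - X^-1) * (1 - t * X^-1) / (a * X^-1 - 1) ^+ 3.
Proof. by move=> X0 aX ->; field; rewrite mulN1r X0. Qed.

Lemma addB_eq0 (L : fieldType) (A B : L) :
  2 != 0 :> L -> A + B = 0 -> A - B = 0 -> A = 0.
Proof.
move=> n2 e e'; apply: (mulfI n2); rewrite mulr0.
by rewrite (_ : 2 * A = (A + B) + (A - B)); [rewrite e e' addr0|ring].
Qed.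

Lemma cross_mult_identity (L : fieldType) (A B A' B' z : L) :
  B != 0 -> B' != 0 -> A / B + A' / B' * z = 0 -> A * B' + A' * B * z = 0.
Proof.
move=> B0 B'0 e; rewrite -(mulr0 (B * B')) -e; field; by rewrite B0 B'0.
Qed.

Lemma map_sqrX_addC (k L : fieldType) (j : {rmorphism k -> L}) (a : k) (u : L) :
  (map_poly j ('X^2 + a%:P)).[u] = u ^+ 2 + j a.
Proof. by rewrite rmorphD /= map_polyXn map_polyC hornerD hornerXn hornerC. Qed.

Lemma inv_xi_identity (L : fieldType) (z v : L) : z != 0 -> v != 0 ->
  z^-1 = z ^+ 2 / v * (v / z ^+ 3).
Proof. by move=> z0 v0; field; rewrite z0 v0. Qed.

(** * Independence of 1 and xi over k(E), and local generators of the direct image *)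

Section LocalBases.
Variables (k : numClosedFieldType) (c : moduli k).
Local Notation t := (mod_t c).
Local Notation t' := (mod_t' c).
Local Notation iota := (const c).
Local Notation xi := (xi c).
Local Notation y := (y c).
Local Notation x := (x c).
Local Notation V := (y / xi ^+ 3).

Lemma two_neq0 : 2 != 0 :> kC c.
Proof. by rewrite -(rmorph_nat iota) fmorph_eq0 pnatr_eq0. Qed.

Lemma xi_sqr : xi ^+ 2 = iota t' - x.
Proof. by rewrite /Defs.x; ring. Qed.

(** No automorphism of k(C) is constructed: (- xi, y) is another solution of the equation of C with
    coordinates in k(C), and the relations between xi and y hold at every solution. *)
Lemma eval2_conj (a : {poly {poly k}}) :
  eval2 iota a xi y = 0 -> eval2 iota a (- xi) y = 0.
Proof.
apply: (eval2_eq0 (G := C_rhs c)); first exact: y_free; first exact: y_sqr.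
by rewrite y_sqr !map_C_rhs sqrrN.
Qed.

Lemma xi_free_poly (a b : {poly {poly k}}) :
  eval2 iota a x y + eval2 iota b x y * xi = 0 ->
  eval2 iota a x y = 0 /\ eval2 iota b x y = 0.
Proof.
have [a' Ea] := eval2_shift t' a; have [b' Eb] := eval2_shift t' b.
move=> e; have : eval2 iota (a' + b' * 'X) xi y = 0.
  by rewrite !eval2E Ea Eb.
move/eval2_conj; rewrite !eval2E Ea Eb sqrrN -/x mulrN.
move: e; move: (eval2 _ _ _ _) (eval2 _ _ _ _) => B A e e'.
have A0 : A = 0.
  exact: addB_eq0 two_neq0 e e'.
split=> //; move/eqP: e; rewrite A0 add0r mulf_eq0 (negPf (xi_neq0 c)) orbF.
by move/eqP.
Qed.

Lemma xi_free (f g : kC c) : field_gen iota x y f -> field_gen iota x y g ->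
  f + g * xi = 0 -> f = 0 /\ g = 0.
Proof.
case=> a [b [b0 ->]] [a' [b' [b'0 ->]]] e.
have [|/eqP + /eqP] := @xi_free_poly (a * b') (a' * b).
  by rewrite !eval2M; apply: cross_mult_identity.
rewrite !eval2M !mulf_eq0 (negPf b0) (negPf b'0) !orbF => /eqP -> /eqP ->.
by rewrite !mul0r.
Qed.

Lemma x_neq_const (a : k) : iota a - x != 0.
Proof.
apply/eqP=> e; have := @xi_transcendental _ c ('X^2 + (a - t')%:P).
rewrite map_sqrX_addC (rmorphB iota) xi_sqr addrC subrKA.
move=> /(_ e)/polyP/(_ 2%N); rewrite coefD coefXn coefC coef0 addr0 => /eqP.
by rewrite oner_eq0.
Qed.

Lemma x_neq0 : x != 0.
Proof. by have := x_neq_const 0; rewrite (rmorph0 iota) sub0r oppr_eq0. Qed.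

Lemma stalk_funfield (P : E c) g : stalk P g -> field_gen iota x y g.
Proof.
have fx := field_gen_fst iota x y; have fy := field_gen_snd iota x y.
case: P => [x0 y0 h|] [r]; apply: field_gen_chart => //; last exact: field_genV.
by apply: field_genM => //; apply: field_genV.
Qed.

Lemma value_x_over_y : value (Einf : E c) (x / y) 0.
Proof. exact: chart_fst. Qed.

Lemma value_inv_y : value (Einf : E c) y^-1 0.
Proof. exact: chart_snd. Qed.

Lemma value_inv_x : value (Einf : E c) x^-1 0.
Proof.
rewrite (inv_x_identity x_neq0 (y_neq0 c) (y_sqr_x c)).
have pE := E_place (Einf : E c); have hu := value_x_over_y; have hv := value_inv_y.
have h2 := placeX pE 2 hu.
have h := placeB pE
  (placeD pE (place1 pE) (placeM pE (placeD pE (place1 pE) (place_const pE t)) h2))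
  (placeM pE (placeM pE (place_const pE t) hu) hv).
have := placeM pE h2 (placeV pE h _); rewrite !(mulr0, expr0n, addr0, subr0) /= mul0r.
by apply; apply: oner_neq0.
Qed.

Lemma y_over_xi3_sqr : V ^+ 2 = y ^+ 2 / (iota t' - x) ^+ 3.
Proof. by rewrite expr_div_n -xi_sqr -!exprM. Qed.

(** V is not in k(E), but its square is, and -1 is the square of the two values that V takes over
    infinity. As it is nonzero, V^2 is a unit there. *)
Lemma value_V_sqr : value (Einf : E c) (V ^+ 2) (-1).
Proof.
rewrite y_over_xi3_sqr.
rewrite (y_over_xi3_identity x_neq0 (x_neq_const t') (y_sqr_x c)).
have pE := E_place (Einf : E c); have hx := value_inv_x.
have h1 := placeB pE (place1 pE) hx.
have h2 := placeB pE (place1 pE) (placeM pE (place_const pE t) hx).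
have h3 := placeX pE 3 (placeB pE (placeM pE (place_const pE t') hx) (place1 pE)).
have := placeM pE (placeM pE h1 h2) (placeV pE h3 _).
rewrite !(mulr0, subr0, sub0r, mulr1, mul1r) -signr_odd /= expr1 invrN invr1.
by apply; rewrite oppr_eq0 oner_neq0.
Qed.

(* Near P, (1, e) is a frame of f_* O_C. *)
Definition local_basis (P : E c) (e : kC c) := forall s : kC c,
  (forall Q : C c, cover Q = P -> stalk Q s) <->
  exists f g, [/\ stalk P f, stalk P g & s = f + g * e].

Lemma local_basisW (P : E c) (e : kC c) :
  (forall Q : C c, cover Q = P -> stalk Q e) ->
  (forall s : kC c, (forall Q : C c, cover Q = P -> stalk Q s) ->
     exists f g, [/\ stalk P f, stalk P g & s = f + g * e]) ->
  local_basis P e.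
Proof.
move=> he H s; split=> [/H //|[f [g [[r hf] [r' hg] ->]]] Q QP].
have [q hq] := he Q QP; have pQ := C_place Q.
exists (r + r' * q); apply: (placeD pQ); last apply: (placeM pQ) => //.
all: by apply: C_value_cover; rewrite QP.
Qed.

Lemma local_basis_aff (x0 y0 : k) (h : y0 ^+ 2 = (E_rhs c).[x0]) :
  local_basis (Eaff h) xi.
Proof.
apply: local_basisW => [[xi0 y1 h'|w h'] // _|s hs].
  by exists xi0; apply: chart_fst.
(* At a branch point w = 0 and the two points of the fibre coincide; the argument needs no separate
   case. *)
pose w := sqrtC (t' - x0); have w2 : w ^+ 2 = t' - x0 by rewrite sqrtCK.
have w2' : (- w) ^+ 2 = t' - x0 by rewrite sqrrN.
have pE := E_place (Eaff h); have hC := C_rhs_cover h w2.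
have nv b : eval2 iota b xi y = 0 -> b.[w, y0] = 0.
  by move=> b0; apply: (place_eq0 (Caff_place hC)); rewrite -b0; apply: chart_eval2.
apply: (@fiber_decomp _ _ iota (value (Eaff h : E c)) xi w pE _
  xi y w y0 (- w) y0) => //.
- rewrite w2 xi_sqr; apply: (placeB pE); first exact: (place_const pE).
  exact: chart_fst.
- exact: (fiber_value_gen _ _ pE).
- by apply: (fiber_value_base _ _ pE); apply: chart_snd.
- apply: (hs (Caff hC)); apply: Eaff_eq => //; by rewrite w2 subKr.
- apply: (hs (Caff (C_rhs_cover h w2'))); apply: Eaff_eq => //.
  by rewrite w2' subKr.
Qed.

Lemma local_basis_inf : local_basis Einf V.
Proof.
apply: local_basisW => [[xi0 y1 h'|w h'] // _|s hs].
  by exists w; apply: chart_snd.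
have pE := E_place (Einf : E c).
have w2 := sqrCi k; have w2' : (- 'i) ^+ 2 = -1 :> k by rewrite sqrrN w2.
have nv b : eval2 iota b xi^-1 V = 0 -> b.[0, 'i] = 0.
  move=> b0; apply: (place_eq0 (Cinf_place c w2)); rewrite -b0; apply: chart_eval2.
have e2 : value (Einf : E c) (V ^+ 2) ('i ^+ 2) by rewrite w2; apply: value_V_sqr.
apply: (@fiber_decomp _ _ iota (value (Einf : E c)) V 'i pE _
  xi^-1 V 0 'i 0 (- 'i)) => //.
(* 1/xi = (xi^2 / y) V, where xi^2 / y = t'/y - x/y is a function on E that vanishes at infinity. *)
- rewrite (inv_xi_identity (xi_neq0 c) (y_neq0 c)).
  have m0 : value (Einf : E c) (xi ^+ 2 / y) 0.
    rewrite xi_sqr mulrBl.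
    have := placeB pE (placeM pE (place_const pE t') value_inv_y) value_x_over_y.
    by rewrite mulr0 subr0.
  have := fiber_valueM pE e2 (fiber_value_base V 'i pE m0) (fiber_value_gen V 'i pE).
  by rewrite !mul0r.
- exact: (fiber_value_gen _ _ pE).
- exact: (hs (Cinf c w2)).
- exact: (hs (Cinf c w2')).
Qed.

Lemma local_basis_unit (P : E c) (e h : kC c) : h != 0 -> stalk P h -> stalk P h^-1 ->
  local_basis P e -> local_basis P (e * h).
Proof.
move=> h0 [r hr] [r' hr'] H s; have pP := E_place P.
rewrite H; split=> -[f [g [hf [q hg] ->]]].
  exists f, (g * h^-1); split=> //; first by exists (q * r'); apply: (placeM pP).
  by rewrite (mulrC e) mulrA mulfVK.
exists f, (g * h); split=> //; first by exists (q * r); apply: (placeM pP).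
by rewrite (mulrC e) mulrA.
Qed.
End LocalBases.

Lemma V_identity (L : fieldType) (z v : L) : z != 0 -> v != 0 ->
  v / z ^+ 3 = z * (v / (z ^+ 2) ^+ 2).
Proof. by move=> z0 v0; field. Qed.

(** * Frames of the direct image and local freeness *)

Section VectorBundle.
Variables (k : numClosedFieldType) (c : moduli k).
Local Notation t := (mod_t c).
Local Notation t' := (mod_t' c).
Local Notation iota := (const c).
Local Notation xi := (xi c).
Local Notation y := (y c).
Local Notation x := (x c).
Local Notation V := (y / xi ^+ 3).

Lemma sum_ord2 (W : nmodType) (F : 'I_2 -> W) : \sum_i F i = F 0 + F 1.
Proof.
by rewrite !big_ord_recl big_ord0 addr0; congr (_ + F _); apply: val_inj.
Qed.

Lemma ord2P (T : 'I_2 -> Prop) : T 0 -> T 1 -> forall i, T i.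
Proof.
by move=> h0 h1 [[|[|//]] hi]; [move: h0|move: h1]; congr T; apply: val_inj.
Qed.

Lemma E_rhsE (x0 : k) : (E_rhs c).[x0] = x0 * (x0 - 1) * (x0 - t).
Proof. by rewrite /E_rhs !hornerE. Qed.

(** In characteristic 0 there are infinitely many points with natural x, too many for a finite
    complement. A point of the open set is what puts the sections of the structure sheaf in k(E). *)
Lemma zopen_neq0 (U : set (E c)) : zopen U -> exists P, U P.
Proof.
rewrite /zopen => fU; apply: contrapT => U0; apply: infinite_nat.
have -> : [set: nat] = (fun n => Eaff (sqrtCK (E_rhs c).[n%:R])) @^-1` (~` U).
  by apply/seteqP; split=> // n _ /= Un; apply: U0; eexists; apply: Un.
apply: finite_preimage => // m n _ _ [] /eqP; by rewrite eqr_nat => /eqP.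
Qed.

Definition basis_1 (e : kC c) : 'I_2 -> kC c := fun i => if i == 0 then 1 else e.

(** Coefficients found near different points agree, because 1 and [xi * h] are independent over
    k(E); hence those found at a single point [P0] are regular on all of [W]. *)
Lemma frame_local_basis (U : set (E c)) (h : kC c) :
  h != 0 -> field_gen iota x y h ->
  (forall P, U P -> local_basis P (xi * h)) ->
  frame (E0 c) U (basis_1 (xi * h)).
Proof.
move=> h0 hF HU W Wo WU.
have free f g : field_gen iota x y f -> field_gen iota x y g ->
    f + g * (xi * h) = 0 -> f = 0 /\ g = 0.
  move=> hf hg; rewrite (mulrC xi) mulrA => /xi_free[] //; first exact: field_genM.
  by move=> -> /eqP; rewrite mulf_eq0 (negPf h0) orbF => /eqP.
have [P0 WP0] := zopen_neq0 Wo.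
split=> [s|a ha]; last first.
  rewrite sum_ord2 /basis_1 /= mulr1 => /free[].
  - exact: stalk_funfield (ha _ _ WP0).
  - exact: stalk_funfield (ha _ _ WP0).
  - by move=> a0 a1; apply: ord2P.
split=> [hs|[a ha ->] Q QW].
  have loc P : W P -> exists f g, [/\ stalk P f, stalk P g & s = f + g * (xi * h)].
    by move=> WP; apply/(HU _ (WU _ WP)) => Q QP; apply: hs; rewrite /= QP.
  have [f [g [hf hg sE]]] := loc _ WP0.
  exists (fun i => if i == 0 then f else g); last first.
    by rewrite sum_ord2 /basis_1 /= mulr1.
  have E2 P : W P -> stalk P f /\ stalk P g.
    move=> /loc [f' [g' [hf' hg' sE']]].
    have [|||ff gg] := free (f - f') (g - g').
    - by apply: field_genD; [|apply: field_genN]; apply: stalk_funfield;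
        [exact: hf|exact: hf'].
    - by apply: field_genD; [|apply: field_genN]; apply: stalk_funfield;
        [exact: hg|exact: hg'].
    - by rewrite mulrBl addrACA -opprD -sE -sE' subrr.
    - by rewrite (subr0_eq ff) (subr0_eq gg).
  by apply: ord2P => P /E2[].
apply: (HU _ (WU _ QW) _).2 (erefl _) => //.
by exists (a 0), (a 1); split; [exact: ha|exact: ha|rewrite sum_ord2 /basis_1 /= mulr1].
Qed.

Lemma frame_aff : frame (E0 c) (~` [set (Einf : E c)]) (basis_1_xi c).
Proof.
rewrite -[basis_1_xi c]/(basis_1 xi) -[xi]mulr1; apply: frame_local_basis.
- exact: oner_neq0.
- exact: field_gen1.
- by case=> [x0 y0 h _|/(_ erefl)//]; rewrite mulr1; apply: local_basis_aff.
Qed.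

(* V = xi (y / (t' - x)^2), so (1, V) is also a frame wherever y and t' - x do not
   vanish. *)
Definition U_inf : set (E c) := [set P : E c |
  if P is Eaff x0 y0 _ then y0 != 0 /\ x0 != t' else True].

Lemma V_eq : V = xi * (y / (iota t' - x) ^+ 2).
Proof.
rewrite -xi_sqr; exact: (V_identity (xi_neq0 c) (y_neq0 c)).
Qed.

Lemma frame_inf : frame (E0 c) U_inf (basis_1 V).
Proof.
have hF : field_gen iota x y (y / (iota t' - x) ^+ 2).
  apply: field_genM; first exact: field_gen_snd.
  by apply: field_genV; rewrite expr2; apply: field_genM; apply: field_genD;
     try exact: field_genC;
     apply: field_genN; apply: field_gen_fst.
have n0 : y / (iota t' - x) ^+ 2 != 0.
  by rewrite mulf_neq0 ?y_neq0 // invr_eq0 expf_neq0 // x_neq_const.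
rewrite V_eq; apply: frame_local_basis => // -[x0 y0 h|] /=; last first.
  by move=> _; rewrite -V_eq; apply: local_basis_inf.
case=> y00 x0t'; have pE := E_place (Eaff h).
have hx : value (Eaff h : E c) x x0 by apply: chart_fst.
have hy : value (Eaff h : E c) y y0 by apply: chart_snd.
have hv := placeM pE hy (placeV pE (placeX pE 2 (placeB pE (place_const pE t') hx)) _).
have d0 : (t' - x0) ^+ 2 != 0 by rewrite expf_neq0 // subr_eq0 eq_sym.
apply: local_basis_unit (local_basis_aff h) => //.
  by eexists; apply: hv.
by eexists; apply: (placeV pE) (hv d0) _; rewrite mulf_neq0 // invr_eq0.
Qed.

Lemma zopen_aff : zopen (~` [set (Einf : E c)]).
Proof. by rewrite /zopen setCK; apply: finite_set1. Qed.

Lemma sign_sqrt_sqr (a : k) (b : bool) : ((-1) ^+ b * sqrtC a) ^+ 2 = a.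
Proof. by rewrite exprMn sqrtCK sqrr_sign mul1r. Qed.

(** An excluded point has y = 0, so that x is 0, 1 or t, or else it has x = t'. Each x carries at
    most two points, enumerated by the sign before a fixed square root. *)
Lemma zopen_inf : zopen U_inf.
Proof.
pose pt (p : k * bool) : E c := Eaff (sign_sqrt_sqr (E_rhs c).[p.1] p.2).
pose s := [seq (a, b) | a <- [:: 0; 1; t; t'], b <- [:: false; true]].
apply: (@sub_finite_set _ _ (pt @` [set` s])); last exact/finite_image/finite_seq.
move=> [x0 y0 h|] /=; last by move=> /(_ Logic.I).
move=> /not_andP nU.
have sx0 : x0 \in [:: 0; 1; t; t'].
  case: nU => /negP; rewrite negbK => /eqP e; last by rewrite e !inE eqxx !orbT.
  move: h; rewrite e expr0n /= E_rhsE => /esym/eqP; rewrite !mulf_eq0 !subr_eq0 !inE.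
  by rewrite -orbA => /or3P[] ->; rewrite ?orbT.
have [b yb] : exists b : bool, (-1) ^+ b * sqrtC (E_rhs c).[x0] = y0.
  have /eqP : y0 ^+ 2 = sqrtC (E_rhs c).[x0] ^+ 2 by rewrite sqrtCK.
  rewrite eqf_sqr => /orP[]/eqP ->; first by exists false; rewrite mul1r.
  by exists true; rewrite mulN1r.
exists (x0, b); last by apply: Eaff_eq.
by apply/allpairsP; exists (x0, b); split=> //; case: (b).
Qed.

Lemma vector_bundle_E0 : vector_bundle 2 (E0 c).
Proof.
split.
- move=> U a s1 s2 _ ha h1 h2 Q QU; have pQ := C_place Q.
  have [r hr] := ha _ QU; have [r1 hr1] := h1 _ QU; have [r2 hr2] := h2 _ QU.
  exists (r * r1 + r2); apply: (placeD pQ) => //; apply: (placeM pQ) => //.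
  exact: C_value_cover.
- move=> U s Uo; split=> [hs P UP|hs Q QU]; first by exists U; split.
  by have [W [Wo WU WQ]] := hs _ QU; apply.
- case=> [x0 y0 h|].
    exists (~` [set (Einf : E c)]), (basis_1_xi c); split=> //.
      exact: zopen_aff.
    exact: frame_aff.
  exists U_inf, (basis_1 V); split=> //; first exact: zopen_inf.
  exact: frame_inf.
Qed.
End VectorBundle.

(** * Forms and change of frame *)

Section Forms.
Variables (k K : fieldType) (iota : {rmorphism k -> K}).
Implicit Types (a b f g : K) (eta theta : form iota).

Lemma dD a b : d iota (a + b) = d iota a + d iota b.
Proof. by apply: funext => D; exact (derD D a b). Qed.

Lemma dM a b : d iota (a * b) = a *: d iota b + b *: d iota a.
Proof. by apply: funext => D; exact (derM D a b). Qed.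

Lemma dC c : d iota (iota c) = 0.
Proof. by apply: funext => D; exact (derC D c). Qed.

Lemma dN a : d iota (- a) = - d iota a.
Proof.
by rewrite -mulN1r dM -(rmorphN1 iota) dC scaler0 addr0 rmorphN1 scaleN1r.
Qed.

Variable S : set K.
Hypotheses (S1 : S 1) (SM : forall a b, S a -> S b -> S (a * b)).

Lemma formsD eta theta : forms iota S eta -> forms iota S theta ->
  forms iota S (eta + theta).
Proof.
case=> s hs -> [s' hs' ->]; exists (s ++ s'); last by rewrite big_cat.
by move=> p; rewrite mem_cat => /orP[/hs|/hs'].
Qed.

Lemma forms0 : forms iota S 0.
Proof. by exists [::] => //; rewrite big_nil. Qed.

Lemma formsZ a eta : S a -> forms iota S eta -> forms iota S (a *: eta).
Proof.
move=> ha [s hs ->]; exists [seq (a * p.1, p.2) | p <- s].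
  by move=> _ /mapP[p /hs[h1 h2] ->]; split=> //; apply: SM.
by rewrite big_map scaler_sumr; apply: eq_bigr => p _; rewrite scalerA.
Qed.

Lemma forms_d a : S a -> forms iota S (d iota a).
Proof.
move=> ha; exists [:: (1, a)]; last by rewrite big_seq1 scale1r.
by move=> p; rewrite inE => /eqP ->.
Qed.

Lemma forms_sum (I : Type) (r : seq I) (eta : I -> form iota) :
  (forall i, forms iota S (eta i)) -> forms iota S (\sum_(i <- r) eta i).
Proof. by move=> h; elim/big_ind: _ => //; [exact: forms0|exact: formsD]. Qed.

End Forms.

Section ChangeOfFrame.
Variables (k K : fieldType) (iota : {rmorphism k -> K}) (X : curve k K).
Hypotheses (pX : forall P : X, place iota (value P))
  (stalk_ff : forall (P : X) g, stalk P g -> funfield X g)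
  (ff1 : funfield X 1)
  (ffM : forall a b, funfield X a -> funfield X b -> funfield X (a * b)).

Lemma stalk1 (P : X) : stalk P 1.
Proof. by exists 1; apply: (place1 (pX P)). Qed.

Lemma stalk_const (P : X) r : stalk P (iota r).
Proof. by exists r; apply: (place_const (pX P)). Qed.

Lemma stalkM (P : X) a b : stalk P a -> stalk P b -> stalk P (a * b).
Proof. by case=> r hr [q hq]; exists (r * q); apply: (placeM (pX P)). Qed.

Lemma stalkD (P : X) a b : stalk P a -> stalk P b -> stalk P (a + b).
Proof. by case=> r hr [q hq]; exists (r + q); apply: (placeD (pX P)). Qed.

Lemma stalkN (P : X) a : stalk P a -> stalk P (- a).
Proof. by case=> r hr; exists (- r); apply: (placeN (pX P)). Qed.

Lemma regularZ (P : X) a (eta : form iota) :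
  stalk P a -> regular_form P eta -> regular_form P (a *: eta).
Proof. by apply: formsZ; apply: stalkM. Qed.

Lemma regular_d (P : X) a : stalk P a -> regular_form P (d iota a).
Proof. by apply: forms_d; apply: stalk1. Qed.

Lemma frame_section n (F : set X -> set K) U (e : 'I_n -> K) V j :
  frame F U e -> zopen V -> V `<=` U -> F V (e j).
Proof.
move=> fe Vo VU; apply/(fe V Vo VU).1; exists (fun i => (i == j)%:R).
  move=> i P _; rewrite -(rmorph_nat iota); exact: stalk_const.
rewrite (bigD1 j) //= eqxx mul1r big1 ?addr0 // => i /negPf ->.
by rewrite mul0r.
Qed.

Lemma frame_coordinates n (F : set X -> set K) U W V (e f : 'I_n -> K) :
  zopen V -> V `<=` U -> V `<=` W -> frame F U e -> frame F W f ->
  exists g : 'I_n -> 'I_n -> K,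
    forall j, (forall i, structure_sheaf V (g j i)) /\ e j = \sum_i g j i * f i.
Proof.
move=> Vo VU VW fe ff.
have ex j : exists a : 'I_n -> K,
    (forall i, structure_sheaf V (a i)) /\ e j = \sum_i a i * f i.
  by have /(ff V Vo VW).1[a ha ea] := frame_section j fe Vo VU; exists a.
by have [g hg] := choice ex; exists g.
Qed.

Variable nabla : K -> form iota.
Hypotheses (nablaD : forall s1 s2, nabla (s1 + s2) = nabla s1 + nabla s2)
  (nablaM : forall a s, nabla (a * s) = s *: d iota a + a *: nabla s).

Lemma nabla_sum n (h e : 'I_n -> K) :
  nabla (\sum_i h i * e i) = \sum_i (e i *: d iota (h i) + h i *: nabla (e i)).
Proof.
have nabla0 : nabla 0 = 0 by apply: (addIr (nabla 0)); rewrite -nablaD !add0r.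
by rewrite (big_morph _ nablaD nabla0); apply: eq_bigr => i _; apply: nablaM.
Qed.

(* The new matrix is g dh + g A h, where f = e h and e = f g. *)
Lemma change_frame n (F : set X -> set K) U W (e f : 'I_n -> K) A P :
  zopen U -> zopen W -> U P -> W P -> frame F U e -> frame F W f ->
  connection_matrix X nabla e A ->
  exists2 B, connection_matrix X nabla f B &
    forall z, stalk P z -> (forall i j, regular_form P (z *: A i j)) ->
      forall i j, regular_form P (z *: B i j).
Proof.
move=> Uo Wo UP WP fe ff [mA hA]; pose V := U `&` W.
have Vo : zopen V by rewrite /zopen setCI finite_setU.
have VU : V `<=` U by move=> Q [].
have VW : V `<=` W by move=> Q [].
have [g hg] := frame_coordinates Vo VU VW fe ff.
have [h hh] := frame_coordinates Vo VW VU ff fe.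
have VP : V P by [].
have sg i j : stalk P (g i j) by apply: (hg i).1.
have sh i j : stalk P (h i j) by apply: (hh i).1.
(* Column j of T = dh + A h expands [nabla (f j)] in the old frame [e]; [h j m] is the coefficient
   of [e m] in [f j]. *)
pose T l j := d iota (h j l) + \sum_m h j m *: A l m.
exists (\matrix_(i, j) \sum_l g l i *: T l j); first split.
- move=> i j; rewrite mxE; apply: forms_sum => l; apply: formsZ => //.
    exact: stalk_ff (sg _ _).
  apply: formsD; first by apply: forms_d => //; apply: stalk_ff (sh _ _).
  apply: forms_sum => m; apply: formsZ => //; last exact: mA.
  exact: stalk_ff (sh _ _).
- move=> j; rewrite (hh j).2 nabla_sum.
  transitivity (\sum_l e l *: T l j).
    under [RHS]eq_bigr do rewrite scalerDr.
    rewrite !big_split /=; congr (_ + _).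
    under eq_bigr do rewrite hA scaler_sumr.
    rewrite exchange_big; apply: eq_bigr => l _ /=; rewrite scaler_sumr.
    by apply: eq_bigr => m _; rewrite !scalerA mulrC.
  under eq_bigr do rewrite (hg _).2 scaler_suml.
  rewrite exchange_big; apply: eq_bigr => i _ /=; rewrite mxE scaler_sumr.
  by apply: eq_bigr => l _; rewrite scalerA mulrC.
(* The term in dh only asks that z be regular. Thus z = 1 transfers regularity, and a uniformizer z
   transfers a pole that is at most simple. *)
- move=> z hz rA i j; rewrite mxE scaler_sumr; apply: forms_sum => l.
  rewrite scalerA mulrC -scalerA; apply: regularZ => //.
  rewrite scalerDr; apply: formsD; first by apply: regularZ => //; apply: regular_d.
  rewrite scaler_sumr; apply: forms_sum => m.
  by rewrite scalerA mulrC -scalerA; apply: regularZ.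
Qed.
End ChangeOfFrame.

(** * Derivations of the function field *)

Section DerivationExtension.
Variables (k K : fieldType) (iota : {rmorphism k -> K}) (G : {poly k}) (u v p q : K).
Hypotheses
  (free : forall b0 b1 : {poly k},
     (map_poly iota b0).[u] + (map_poly iota b1).[u] * v = 0 -> b0 = 0 /\ b1 = 0)
  (v_sqr : v ^+ 2 = (map_poly iota G).[u])
  (gen : forall s, field_gen iota u v s)
  (rel : 2 * v * q = (map_poly iota G^`()).[u] * p).
Implicit Types (a b : {poly {poly k}}).

(* The evaluation at (u + p 'X, v + q 'X), whose first order part at 0 is the
   derivative of a(u, v) in the direction (p, q). *)
Definition jet a : {poly K} :=
  (map_poly (map_poly (polyC \o iota)) a).[u%:P + p *: 'X, v%:P + q *: 'X].

Definition der2 a : K := (jet a)^`().[0].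

Lemma jet0 a : (jet a).[0] = eval2 iota a u v.
Proof.
elim/poly2_ind: a => [r|a b ha hb|a ha|a ha].
- by rewrite eval2C /jet !map_polyC /= !map_polyC /= !hornerC.
- by rewrite eval2D -ha -hb /jet rmorphD !hornerD.
- rewrite eval2M eval2X -ha /jet rmorphM /= map_polyX !hornerM hornerX.
  by rewrite !hornerC hornerD hornerZ hornerX hornerC mulr0 addr0.
- rewrite eval2M eval2Y -ha /jet rmorphM /= map_polyC /= map_polyX !hornerM hornerC.
  by rewrite hornerX hornerD hornerZ hornerX hornerC mulr0 addr0.
Qed.

Lemma der2D a b : der2 (a + b) = der2 a + der2 b.
Proof. by rewrite /der2 /jet rmorphD !hornerD derivD hornerD. Qed.

Lemma der2N a : der2 (- a) = - der2 a.
Proof. by rewrite /der2 /jet rmorphN !hornerN derivN hornerN. Qed.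

Lemma der2M a b :
  der2 (a * b) = der2 a * eval2 iota b u v + eval2 iota a u v * der2 b.
Proof.
rewrite -!jet0 /der2 (_ : jet (a * b) = jet a * jet b).
  by rewrite derivM hornerD !hornerM.
by rewrite /jet rmorphM !hornerM.
Qed.

Lemma der2C r : der2 r%:P%:P = 0.
Proof.
by rewrite /der2 /jet !map_polyC /= !map_polyC /= !hornerC derivC horner0.
Qed.

Lemma der2X : der2 'X = p.
Proof.
rewrite /der2 /jet map_polyX hornerX hornerC derivD derivC add0r derivZ derivX.
by rewrite hornerZ hornerC mulr1.
Qed.

Lemma der2Y : der2 'X%:P = q.
Proof.
rewrite /der2 /jet map_polyC /= map_polyX hornerC hornerX derivD derivC add0r.
by rewrite derivZ derivX hornerZ hornerC mulr1.
Qed.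

(** By [rel] the derivative of [Y^2 - G] in the direction (p, q) vanishes at (u, v), so replacing
    [a] by its remainder [a0 + a1 Y] does not change the derivative. *)
Lemma der2_reduce a : exists a0 a1 : {poly k},
  eval2 iota a u v = (map_poly iota a0).[u] + (map_poly iota a1).[u] * v /\
  der2 a = ((map_poly iota a0^`()).[u] + (map_poly iota a1^`()).[u] * v) * p
           + (map_poly iota a1).[u] * q.
Proof.
elim/poly2_ind: a => [r|a b|a|a].
- exists r%:P, 0; rewrite eval2C der2C derivC deriv0 map_polyC !rmorph0 hornerC.
  rewrite !horner0.
  by split; ring.
- case=> a0 [a1 [ea da]] [b0 [b1 [eb db]]]; exists (a0 + b0), (a1 + b1).
  rewrite eval2D der2D ea eb da db !derivD !rmorphD !hornerD; split; ring.
- case=> a0 [a1 [ea da]]; exists (a0 * 'X), (a1 * 'X).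
  rewrite eval2M der2M eval2X der2X ea da !derivM !derivX !rmorphD !rmorphM /=.
  by rewrite !map_polyX !rmorph1 !(hornerD, hornerM, hornerX, hornerC); split; ring.
- case=> a0 [a1 [ea da]]; exists (a1 * G), a0.
  rewrite eval2M der2M eval2Y der2Y ea da !derivM !rmorphD !rmorphM /=.
  rewrite !(hornerD, hornerM) -v_sqr; split; first ring.
  rewrite [in RHS]mulrDl [X in _ = X + _ + _]mulrDl -[X in _ = _ + X + _ + _]mulrA -rel.
  ring.
Qed.

Lemma der2_eq0 a : eval2 iota a u v = 0 -> der2 a = 0.
Proof.
have [a0 [a1 [-> ->]]] := der2_reduce a.
by move=> /free[-> ->]; rewrite !deriv0 !rmorph0 !horner0 !mul0r !addr0 mul0r.
Qed.

(** The quotient rule cleared of denominators. It is a relation because s has many representations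
    as a fraction; [der_spec_fun] shows that the choice does not matter. *)
Definition der_spec (s r : K) := exists a b, [/\ eval2 iota b u v != 0,
  s * eval2 iota b u v = eval2 iota a u v &
  r * eval2 iota b u v + s * der2 b = der2 a].

Lemma der_spec_fun s r r' : der_spec s r -> der_spec s r' -> r = r'.
Proof.
case=> a [b [b0 sb rb]] [a' [b' [b'0 sb' rb']]].
have : eval2 iota (a * b' - a' * b) u v = 0 by rewrite !eval2E -sb -sb'; ring.
move/der2_eq0; rewrite der2D der2N !der2M -rb -rb' -sb -sb' => e.
apply/eqP; rewrite -subr_eq0; apply/eqP/(mulIf (mulf_neq0 b0 b'0)).
by rewrite mul0r -e; ring.
Qed.

Lemma der_spec_ex s : exists r, der_spec s r.
Proof.
have [a [b [b0 ->]]] := gen s.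
pose g := eval2 iota a u v / eval2 iota b u v.
exists ((der2 a - g * der2 b) / eval2 iota b u v), a, b; rewrite /g.
by rewrite !divfK // subrK.
Qed.

Lemma derivation_extension : exists D : derivation iota, D u = p /\ D v = q.
Proof.
have [D hD] := choice der_spec_ex.
have DD (a b : K) : D (a + b) = D a + D b.
  apply: (der_spec_fun (hD _)).
  have [a1 [b1 [n1 e1 d1]]] := hD a; have [a2 [b2 [n2 e2 d2]]] := hD b.
  exists (a1 * b2 + a2 * b1), (b1 * b2).
  rewrite !eval2E der2D !der2M mulf_neq0 // -e1 -e2 -d1 -d2; split=> //; ring.
have DM (a b : K) : D (a * b) = a * D b + b * D a.
  apply: (der_spec_fun (hD _)).
  have [a1 [b1 [n1 e1 d1]]] := hD a; have [a2 [b2 [n2 e2 d2]]] := hD b.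
  exists (a1 * a2), (b1 * b2).
  rewrite !eval2E !der2M mulf_neq0 // -e1 -e2 -d1 -d2; split=> //; ring.
have poly a : D (eval2 iota a u v) = der2 a.
  apply: (der_spec_fun (hD _)); exists a, 1%:P%:P.
  by rewrite eval2C rmorph1 oner_neq0 der2C !mulr1 mulr0 addr0.
have DC c : D (iota c) = 0.
  by rewrite -(eval2C iota c u v) poly der2C.
exists (Derivation DD DM DC); split=> /=.
  by rewrite -[u in D u](eval2X iota u v) poly der2X.
by rewrite -[v in D v](eval2Y iota u v) poly der2Y.
Qed.
End DerivationExtension.

Section DerivationRules.
Variables (k K : fieldType) (iota : {rmorphism k -> K}) (D : derivation iota).

Lemma der1 : D 1 = 0. Proof. by rewrite -(rmorph1 iota) derC. Qed.

Lemma der_sqr a : D (a ^+ 2) = 2 * a * D a.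
Proof. by rewrite expr2 derM; ring. Qed.

Lemma derN a : D (- a) = - D a.
Proof. by rewrite -mulN1r derM -(rmorphN1 iota) derC mulr0 addr0 rmorphN1 mulN1r. Qed.

Lemma der_div a b : b != 0 -> D (a / b) = (D a - a / b * D b) / b.
Proof.
move=> b0; apply: (mulIf b0); rewrite divfK //.
have := derM D (a / b) b; rewrite divfK // => ->; ring.
Qed.

Lemma form_sum_der (I : Type) (r : seq I) (eta : I -> form iota) :
  (\sum_(i <- r) eta i) D = \sum_(i <- r) eta i D.
Proof. by elim/big_rec2: _ => // i x y _ <-. Qed.

(** Contraction with a derivation that preserves [S] reduces questions on forms to questions on
    functions. *)
Lemma forms_der (S : set K) eta : S 0 ->
  (forall a b, S a -> S b -> S (a + b)) -> (forall a b, S a -> S b -> S (a * b)) ->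
  (forall a, S a -> S (D a)) -> forms iota S eta -> S (eta D).
Proof.
move=> S0 SD SM SD' [s hs ->]; rewrite form_sum_der.
elim: s hs => [|q s IH] hs; first by rewrite big_nil.
rewrite big_cons; apply: SD.
  have [h1 h2] : S q.1 /\ S q.2 by apply: hs; rewrite inE eqxx.
  by apply: SM h1 _; apply: SD'.
by apply: IH => r hr; apply: hs; rewrite inE hr orbT.
Qed.

Lemma eval2_der (u v : K) (S : set K) (a : {poly {poly k}}) :
  (forall r, S (iota r)) ->
  (forall f g, S f -> S g -> S (f + g)) -> (forall f g, S f -> S g -> S (f * g)) ->
  S u -> S v -> S (D u) -> S (D v) ->
  S (eval2 iota a u v) /\ S (D (eval2 iota a u v)).
Proof.
move=> SC SD SM Su Sv SDu SDv.
elim/poly2_ind: a => [s|a1 b1 [h1 h2] [h3 h4]|a1 [h1 h2]|a1 [h1 h2]].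
- by rewrite eval2C derC -(rmorph0 iota).
- by rewrite eval2D derD; split; apply: SD.
- by rewrite eval2M eval2X derM; split; [apply: SM|apply: SD; apply: SM].
- by rewrite eval2M eval2Y derM; split; [apply: SM|apply: SD; apply: SM].
Qed.

Lemma fraction_der (u v : K) (S : set K) (a b : {poly {poly k}}) :
  (forall r, S (iota r)) ->
  (forall f g, S f -> S g -> S (f + g)) -> (forall f g, S f -> S g -> S (f * g)) ->
  S u -> S v -> S (D u) -> S (D v) ->
  eval2 iota b u v != 0 -> S (eval2 iota b u v)^-1 ->
  S (D (eval2 iota a u v / eval2 iota b u v)).
Proof.
move=> SC SD SM Su Sv SDu SDv b0 SVb.
have [Sa SDa] := eval2_der a SC SD SM Su Sv SDu SDv.
have [Sb SDb] := eval2_der b SC SD SM Su Sv SDu SDv.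
have SN f : S f -> S (- f).
  by move=> h; rewrite -mulN1r -(rmorphN1 iota); apply: SM.
rewrite der_div //; apply: (SM _ _ _ SVb); apply: (SD _ _ SDa); apply: SN.
by apply: (SM _ _ _ SDb); apply: SM.
Qed.
End DerivationRules.

(** * Uniformizers and the form dx / y *)

Section Uniformizers.
Variables (k : numClosedFieldType) (c : moduli k).
Local Notation t := (mod_t c).
Local Notation iota := (const c).
Local Notation xi := (xi c).
Local Notation y := (y c).
Local Notation x := (x c).
Local Notation pE := (@E_place _ c).

Lemma stalkV (P : E c) f r : value P f r -> r != 0 -> stalk P f^-1.
Proof. by move=> h r0; exists r^-1; apply: (placeV (pE P)). Qed.

(** The maximal ideal at P is generated by u - u0 and v - v0, so divisibility of these two by z
    suffices. *)
Lemma chart_uniformizer (P : E c) (u v z : kC c) (u0 v0 : k) :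
  (forall g r, value P g r <-> value_at_chart iota u v u0 v0 g r) ->
  value P z 0 ->
  (exists2 h, stalk P h & u - iota u0 = h * z) ->
  (exists2 h, stalk P h & v - iota v0 = h * z) -> uniformizer P z.
Proof.
move=> ch z0 [hu shu eu] [hv shv ev]; split=> // g /ch [a [b [b0 -> r0]]].
have [h sh eh] : exists2 h, stalk P h & eval2 iota a u v - iota a.[u0, v0] = h * z.
  rewrite horner2E; elim/poly2_ind: a {r0} =>
    [r|a1 b1 [h1 s1 e1] [h2 s2 e2]|a1 [h1 s1 e1]|a1 [h1 s1 e1]].
  - by exists 0; rewrite ?eval2C ?subrr ?mul0r //; exists 0; apply: place0 (pE P).
  - exists (h1 + h2); first exact: (stalkD pE).
    by rewrite !eval2D (rmorphD iota) opprD addrACA e1 e2 mulrDl.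
  - exists (h1 * u + iota (eval2 idfun a1 u0 v0) * hu).
      apply: (stalkD pE); apply: (stalkM pE) => //; last exact: (stalk_const pE).
      by exists u0; apply/ch; apply: chart_fst.
    rewrite !eval2M !eval2X (rmorphM iota) mulrDl mulrAC -e1 -mulrA -eu.
    by rewrite mulrBl mulrBr addrA subrK.
  - exists (h1 * v + iota (eval2 idfun a1 u0 v0) * hv).
      apply: (stalkD pE); apply: (stalkM pE) => //; last exact: (stalk_const pE).
      by exists v0; apply/ch; apply: chart_snd.
    rewrite !eval2M !eval2Y (rmorphM iota) mulrDl mulrAC -e1 -mulrA -ev.
    by rewrite mulrBl mulrBr addrA subrK.
have a0 : a.[u0, v0] = 0.
  by move/esym/eqP: r0; rewrite mulf_eq0 invr_eq0 (negPf b0) orbF => /eqP.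
move: eh; rewrite a0 (rmorph0 iota) subr0 => ->.
exists (h / eval2 iota b u v); last by rewrite mulrAC.
apply: (stalkM pE) => //; apply: (stalkV (r := b.[u0, v0])) => //.
by apply/ch; apply: chart_eval2.
Qed.

(* The divided difference of the cubic X (X - 1) (X - s); at X0 = X it is the
   derivative. *)
Definition E_slope (L : fieldType) (s X X0 : L) :=
  X ^+ 2 + X * X0 + X0 ^+ 2 - (1 + s) * (X + X0) + s.

Lemma E_slopeE (L : fieldType) (s X X0 : L) :
  X * (X - 1) * (X - s) - X0 * (X0 - 1) * (X0 - s) = E_slope s X X0 * (X - X0).
Proof. by rewrite /E_slope; ring. Qed.

Lemma value_slope (P : E c) f g r q : value P f r -> value P g q ->
  value P (E_slope (iota t) f g) (E_slope t r q).
Proof.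
have p := pE P; have C a := place_const p a; move=> hf hg.
exact (placeD p
  (placeB p (placeD p (placeD p (placeX p 2 hf) (placeM p hf hg)) (placeX p 2 hg))
  (placeM p (placeD p (place1 p) (C t)) (placeD p hf hg))) (C t)).
Qed.

Section Affine.
Variables (x0 y0 : k) (h : y0 ^+ 2 = (E_rhs c).[x0]).
Let P : E c := Eaff h.

Lemma value_x : value P x x0. Proof. exact: chart_fst. Qed.
Lemma value_y : value P y y0. Proof. exact: chart_snd. Qed.

Lemma value_slope_x :
  value P (E_slope (iota t) x (iota x0)) (E_slope t x0 x0).
Proof. exact: value_slope value_x (place_const (pE P) x0). Qed.

Lemma slope_y : (y - iota y0) * (y + iota y0) =
  E_slope (iota t) x (iota x0) * (x - iota x0).
Proof.
have e : iota (y0 ^+ 2) = iota x0 * (iota x0 - 1) * (iota x0 - iota t).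
  by rewrite h E_rhsE !(rmorphM iota) !(rmorphB iota) (rmorph1 iota).
by rewrite -E_slopeE -y_sqr_x -e (rmorphXn iota); apply/esym/subr_sqr.
Qed.

Lemma uniformizer_x : y0 != 0 -> uniformizer P (x - iota x0).
Proof.
move=> y00; have p := pE P.
have z0 : value P (x - iota x0) 0.
  by rewrite -(subrr x0); apply: (placeB p); [apply: value_x|apply: (place_const p)].
apply: (@chart_uniformizer P x y _ x0 y0) => //.
  by exists 1; [apply: (stalk1 pE)|rewrite mul1r].
have hs : value P (y + iota y0) (y0 + y0).
  exact: (placeD p) value_y (place_const p y0).
have s0 : y0 + y0 != 0 by rewrite -mulr2n mulrn_eq0.
exists (E_slope (iota t) x (iota x0) / (y + iota y0)).
  by apply: (stalkM pE); [eexists; apply: value_slope_x|apply: stalkV hs s0].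
by rewrite mulrAC -slope_y mulfK // (place_neq0 p hs s0).
Qed.

(** Smoothness of E: the roots 0, 1, t of the cubic are simple, so its derivative does not vanish at
    them. *)
Lemma slope_neq0 : y0 = 0 -> E_slope t x0 x0 != 0.
Proof.
have [t0 t1] := (t_neq0 c, t_neq1 c).
move=> y00; move: h; rewrite y00 expr0n /= E_rhsE => /esym/eqP.
rewrite !mulf_eq0 !subr_eq0 -orbA /E_slope => /or3P[]/eqP ->.
- by rewrite (_ : _ + _ = t) //; ring.
- by rewrite (_ : _ + _ = 1 - t) ?subr_eq0 1?eq_sym //; ring.
- by rewrite (_ : _ + _ = t * (t - 1)) ?mulf_neq0 ?subr_eq0 //; ring.
Qed.

Lemma uniformizer_y : y0 = 0 -> uniformizer P y.
Proof.
move=> y00; have p := pE P; have hs := value_slope_x; have s0 := slope_neq0 y00.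
have yz : value P y 0 by rewrite -y00; apply: value_y.
have sy := slope_y; rewrite y00 (rmorph0 iota) subr0 addr0 in sy.
apply: (@chart_uniformizer P x y _ x0 y0) => //.
  exists (y / E_slope (iota t) x (iota x0)).
    by apply: (stalkM pE); [exists 0|apply: stalkV hs s0].
  by rewrite mulrAC sy [X in X / _]mulrC mulfK // (place_neq0 p hs s0).
exists 1; first exact: (stalk1 pE).
by rewrite y00 (rmorph0 iota) subr0 mul1r.
Qed.

Lemma uniformizer_aff : exists z, uniformizer P z.
Proof.
have [y00|y00] := eqVneq y0 0; first by exists y; apply: uniformizer_y.
by exists (x - iota x0); apply: uniformizer_x.
Qed.
End Affine.

Lemma uniformizer_inf : uniformizer (Einf : E c) (x / y).
Proof.
have p := pE Einf.
apply: (@chart_uniformizer Einf (x / y) y^-1 _ 0 0) => //.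
- exact: value_x_over_y.
- by exists 1; [apply: (stalk1 pE)|rewrite mul1r (rmorph0 iota) subr0].
- exists x^-1; first by exists 0; apply: value_inv_x.
  by rewrite (rmorph0 iota) subr0 mulrA mulVf ?x_neq0 // mul1r.
Qed.
End Uniformizers.

(** With F(u, v) = v - u (u - v) (u - s v), the equation of E near infinity, the factor on the left
    is the partial derivative F_v at u = X/Y, v = 1/Y. The identity is dX/Y = - 2 du / F_v, and F_v
    = 1 at infinity. *)
Lemma slope_der_identity (L : fieldType) (X Y s dX dY : L) : Y != 0 ->
  Y ^+ 2 = X * (X - 1) * (X - s) -> 2 * Y * dY = E_slope s X X * dX ->
  (1 + (1 + s) * (X / Y) ^+ 2 - 2 * s * (X / Y) * Y^-1) * (Y^-1 * dX) =
  -2 * ((dX - X / Y * dY) / Y).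
Proof.
move=> Y0 e de; apply: (mulIf (expf_neq0 3 Y0)).
transitivity ((Y ^+ 2 + (1 + s) * X ^+ 2 - 2 * s * X) * dX); first by field.
transitivity (-2 * Y ^+ 2 * dX + X * (2 * Y * dY)); last by field.
by rewrite de e /E_slope; ring.
Qed.

Lemma dx_y_coef (L : fieldType) (S v : L) : S != 0 -> v != 0 ->
  v^-1 / S * (2 * v) = 2 / S.
Proof. by move=> S0 v0; field; rewrite S0. Qed.

Lemma der_cubic (k L : fieldType) (iota : {rmorphism k -> L})
    (D : derivation iota) s X :
  D (X * (X - 1) * (X - iota s)) = E_slope (iota s) X X * D X.
Proof. by rewrite !derM !derD !derN (derC D) der1 /E_slope; ring. Qed.

Section DifferentialIdentities.
Variables (L : fieldType) (l1 l2 z v dz dx : L).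
Hypotheses (n2 : 2 != 0 :> L) (z0 : z != 0) (v0 : v != 0) (hdx : dx = - (2 * z * dz)).
Let om := l1 / v * dz + l2 * z / v * dz.

Lemma nabla_1_identity : 0 + 1 * om =
  1 * (- (l2 / (2 * v)) * dx) + z * (- (l1 / (2 * z ^+ 2 * v)) * dx).
Proof. by rewrite hdx /om; field; rewrite n2 z0 v0. Qed.

Lemma nabla_xi_identity : dz + z * om =
  1 * (- (l1 / (2 * v)) * dx) + z * (- (l2 / (2 * v) + 1 / (2 * z ^+ 2)) * dx).
Proof. by rewrite hdx /om; field; rewrite n2 z0 v0. Qed.

Lemma nabla_1_inf_identity : 0 + 1 * om =
  1 * (- (l2 / 2) * (v^-1 * dx)) +
  (v / z ^+ 3) * (- (l1 / 2 * (z ^+ 2 / v)) * (v^-1 * dx)).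
Proof. by rewrite hdx /om; field; rewrite n2 z0 v0. Qed.

(** The product [2 * V * dV] is kept together because it is d(V^2), and V^2 is a function on E while
    V is not. *)
Lemma nabla_V_inf_identity (V dV : L) : V = v / z ^+ 3 -> dV + V * om =
  1 * (- (l1 / 2 * (V ^+ 2 * (z ^+ 2 / v))) * (v^-1 * dx)) +
  V * (- (l2 / 2) * (v^-1 * dx) + (2 * V ^+ 2)^-1 * (2 * V * dV)).
Proof. by move=> ->; rewrite hdx /om; field; rewrite n2 z0 v0. Qed.

End DifferentialIdentities.

Section InvariantForm.
Variables (k : numClosedFieldType) (c : moduli k).
Local Notation t := (mod_t c).
Local Notation iota := (const c).
Local Notation xi := (xi c).
Local Notation y := (y c).
Local Notation x := (x c).
Local Notation pE := (@E_place _ c).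
Local Notation dx := (d iota x).

Lemma der_x (d : derivation iota) : d x = - (2 * xi * d xi).
Proof. by rewrite derD derN derC add0r der_sqr. Qed.

Lemma der_y (d : derivation iota) : 2 * y * d y = E_slope (iota t) x x * d x.
Proof. by rewrite -der_sqr y_sqr_x der_cubic. Qed.

Lemma slope_dx : (2 * y) *: d iota y = E_slope (iota t) x x *: dx.
Proof. by apply: funext => d; exact (der_y d). Qed.

Lemma dx_over_y_regular (P : E c) : regular_form P (y^-1 *: dx).
Proof.
case: P => [x0 y0 h|].
  have sx : stalk (Eaff h : E c) x by exists x0; apply: value_x.
  have [y00|y00] := eqVneq y0 0; last first.
    apply: (regularZ pE); last exact: (regular_d pE).
    exact: stalkV (value_y h) y00.
  have p := pE (Eaff h); have hs := value_slope (value_x h) (value_x h).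
  have s0 := slope_neq0 h y00; have S0 := place_neq0 p hs s0.
  (* Where y vanishes, 2 y dy = P'(x) dx for the cubic P gives dx / y = 2 dy / P'(x), with P'(x0)
     nonzero. *)
  rewrite (_ : y^-1 *: dx = (2 / E_slope (iota t) x x) *: d iota y).
    apply: (regularZ pE).
      apply: (stalkM pE); last exact: stalkV hs s0.
      by rewrite -(rmorph_nat iota); apply: (stalk_const pE).
    by apply: (regular_d pE); exists y0; apply: value_y.
  rewrite -[dx](scalerK S0) -slope_dx !scalerA.
  by congr (_ *: _); have := y_neq0 c; move: S0 => S0 y1; apply: dx_y_coef.
have hu := value_x_over_y c; have hv := value_inv_y c.
have p := pE Einf; have C a := place_const p a.
pose w := 1 + (1 + iota t) * (x / y) ^+ 2 - 2 * iota t * (x / y) * y^-1.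
have hw : value (Einf : E c) w 1.
  have h2 : value (Einf : E c) 2 2 by rewrite -[X in value _ X _](rmorph_nat iota).
  have := placeB p
    (placeD p (place1 p) (placeM p (placeD p (place1 p) (C t)) (placeX p 2 hu)))
    (placeM p (placeM p (placeM p h2 (C t)) hu) hv).
  by rewrite expr0n /= !mulr0 addr0 subr0.
have w0 := place_neq0 p hw (oner_neq0 _).
rewrite (_ : y^-1 *: dx = (w^-1 * -2) *: d iota (x / y)).
  apply: (regularZ pE); last by apply: (regular_d pE); exists 0.
  apply: (stalkM pE); first exact: stalkV hw (oner_neq0 _).
  by rewrite -(rmorph_nat iota) -(rmorphN iota); apply: (stalk_const pE).
apply: (scalerI w0); rewrite [RHS]scalerA mulrA mulfV // mul1r.
apply: funext => d.
have := slope_der_identity (y_neq0 c) (y_sqr_x c) (der_y d).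
by rewrite -(der_div d x (y_neq0 c)); exact.
Qed.
End InvariantForm.

(** * Connection matrices, poles and residues *)

Section Residues.
Variables (k : numClosedFieldType) (c : moduli k) (lambda1 lambda2 : k).
Local Notation t' := (mod_t' c).
Local Notation iota := (const c).
Local Notation xi := (xi c).
Local Notation y := (y c).
Local Notation x := (x c).
Local Notation V := (y / xi ^+ 3).
Local Notation dx := (d iota x).
Local Notation l1 := (iota lambda1).
Local Notation l2 := (iota lambda2).
Local Notation D := (nabla c lambda1 lambda2).
Local Notation F := (field_gen iota x y).

Definition matrix_aff : 'M[form iota]_2 := mx2
  (- (l2 / (2 * y)) *: dx)               (- (l1 / (2 * y)) *: dx)
  (- (l1 / (2 * (iota t' - x) * y)) *: dx)
                      (- (l2 / (2 * y) + 1 / (2 * (iota t' - x))) *: dx).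

(** The entries are built from dx / y, V^2 and (t' - x) / y, all regular at infinity, with V^2 a
    unit; regularity of the matrix can thus be read off. *)
Definition matrix_inf : 'M[form iota]_2 :=
  let w := y^-1 *: dx in
  mx2 (- (l2 / 2) *: w) (- (l1 / 2 * (V ^+ 2 * ((iota t' - x) / y))) *: w)
      (- (l1 / 2 * ((iota t' - x) / y)) *: w)
                        (- (l2 / 2) *: w + (2 * V ^+ 2)^-1 *: d iota (V ^+ 2)).

Lemma mx2P (T : Type) (R : 'I_2 -> 'I_2 -> T -> Prop) (a b a' b' : T) :
  R 0 0 a -> R 0 1 b -> R 1 0 a' -> R 1 1 b' ->
  forall i j, R i j (mx2 a b a' b' i j).
Proof. by move=> h1 h2 h3 h4; apply: ord2P; apply: ord2P; rewrite mxE. Qed.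

Lemma F_x : F x. Proof. exact: field_gen_fst. Qed.
Lemma F_y : F y. Proof. exact: field_gen_snd. Qed.
Lemma F_2 : F 2. Proof. by rewrite -(rmorph_nat iota); apply: field_genC. Qed.
Lemma F_z : F (iota t' - x).
Proof. by apply: field_genD; [apply: field_genC|apply: field_genN; apply: F_x]. Qed.

Lemma mero_d (g : kC c) : F g -> mero_form (E c) (d iota g).
Proof. by apply: forms_d; apply: field_gen1. Qed.

Lemma mero_Z (f : kC c) (eta : form iota) :
  F f -> mero_form (E c) eta -> mero_form (E c) (f *: eta).
Proof. by apply: formsZ; apply: field_genM. Qed.

Lemma F_V_sqr : F (V ^+ 2).
Proof. by apply: (@stalk_funfield _ _ Einf); exists (-1); apply: value_V_sqr. Qed.

Lemma matrix_aff_connection : connection_matrix (E c) D (basis_1_xi c) matrix_aff.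
Proof.
have Fx := F_x; have Fy := F_y; have F2 := F_2; have Fz := F_z.
have FV := @field_genV _ _ iota x y; have FM := @field_genM _ _ iota x y.
have FN := @field_genN _ _ iota x y; have FD := @field_genD _ _ iota x y.
have FC := field_genC iota x y; have F1 := field_gen1 iota x y.
split.
  apply: (mx2P (R := fun _ _ => mero_form (E c))); apply: mero_Z; try exact: mero_d.
  - by apply: (FN); apply: (FM) => //; apply: (FV); apply: (FM).
  - by apply: (FN); apply: (FM) => //; apply: (FV); apply: (FM).
  - by apply: (FN); apply: (FM) => //; apply: (FV); apply: (FM) => //; apply: (FM).
  - by apply: (FN); apply: (FD); apply: (FM) => //; apply: (FV); apply: (FM).
apply: ord2P; rewrite sum_ord2 !mxE /=; apply: funext => d.
  have := nabla_1_identity (iota lambda1) (iota lambda2)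
    (two_neq0 c) (xi_neq0 c) (y_neq0 c) (der_x d).
  by rewrite xi_sqr -[X in X + _](der1 d); exact.
have := nabla_xi_identity (iota lambda1) (iota lambda2)
    (two_neq0 c) (xi_neq0 c) (y_neq0 c) (der_x d).
by rewrite xi_sqr; exact.
Qed.

Lemma matrix_inf_connection : connection_matrix (E c) D (basis_1 V) matrix_inf.
Proof.
have Fx := F_x; have Fy := F_y; have F2 := F_2; have Fz := F_z.
have FV := @field_genV _ _ iota x y; have FM := @field_genM _ _ iota x y.
have FN := @field_genN _ _ iota x y; have FD := @field_genD _ _ iota x y.
have FC := field_genC iota x y; have F1 := field_gen1 iota x y; have FVV := F_V_sqr.
have Fh z : F (iota z / 2) by apply: (FM) => //; apply: (FV).
have Fzy : F ((iota t' - x) / y) by apply: (FM) => //; apply: (FV).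
have mw : mero_form (E c) (y^-1 *: dx).
  by apply: mero_Z; [apply: (FV)|apply: mero_d].
split.
  apply: (mx2P (R := fun _ _ => mero_form (E c))).
  - by apply: mero_Z => //; apply: (FN).
  - by apply: mero_Z => //; apply: (FN); apply: (FM) => //; apply: (FM).
  - by apply: mero_Z => //; apply: (FN); apply: (FM).
  - apply: formsD; first by apply: mero_Z => //; apply: (FN).
    by apply: mero_Z; [apply: (FV); apply: (FM)|apply: mero_d].
apply: ord2P; rewrite sum_ord2 !mxE /=; apply: funext => d.
  have := nabla_1_inf_identity (iota lambda1) (iota lambda2)
    (two_neq0 c) (xi_neq0 c) (y_neq0 c) (der_x d).
  by rewrite xi_sqr -[X in X + _](der1 d); exact.
have := nabla_V_inf_identity (iota lambda1) (iota lambda2)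
    (two_neq0 c) (xi_neq0 c) (y_neq0 c)
  (der_x d) (d V) (erefl V).
by rewrite xi_sqr -der_sqr; exact.
Qed.
End Residues.

Lemma half_cancel (L : fieldType) (a v : L) : 2 != 0 :> L -> v != 0 ->
  a = 2 * v * a / 2 * v^-1.
Proof. by move=> n2 v0; field; rewrite n2 v0. Qed.

Lemma column_identity (L : fieldType) (a b a' b' z : L) :
  1 * a + z * b = 1 * a' + z * b' -> a - a' + (b - b') * z = 0.
Proof.
move=> e; rewrite (_ : _ + _ = (1 * a + z * b) - (1 * a' + z * b')); last by ring.
by rewrite e subrr.
Qed.

Section CoefIdentities.
Variables (L : fieldType) (z l v s v1 h : L).
Hypotheses (n2 : 2 != 0 :> L) (v0 : v != 0) (s0 : s != 0).

Lemma coef_y : - (l / (2 * v)) = - (l / 2) * v^-1.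
Proof. by field; rewrite n2 v0. Qed.

Lemma coef_sy : z * - (l / (2 * s * v)) = - (l / 2) * (z / s) * v^-1.
Proof. by field; rewrite n2 v0 s0. Qed.

Lemma coef_diag : z * - (l / (2 * v) + 1 / (2 * s)) =
  z * - (l / 2) * v^-1 + - (1 / 2) * (z / s).
Proof. by field; rewrite n2 v0 s0. Qed.

(** The polar part splits off through 1/v = 1/v1 - (v - v1) / (v v1), where v - v1 is a multiple of
    the uniformizer - s. *)
Lemma coef_res : v1 != 0 -> v - v1 = h * - s ->
  - (l / (2 * s * v)) = l / (2 * v1) / (- s) + - (l / 2 * h / (v * v1)).
Proof.
move=> v10 e; rewrite (_ : h = - ((v - v1) / s)); last first.
  by rewrite e mulrN mulNr opprK mulfK.
by field; rewrite ?mulN1r ?oppr_eq0 ?n2 ?v0 ?s0 ?v10.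
Qed.

Lemma coef_res_diag : - (l / (2 * v) + 1 / (2 * s)) = 1 / 2 / (- s) + - (l / (2 * v)).
Proof. by field; rewrite ?mulN1r ?oppr_eq0 ?n2 ?v0 ?s0. Qed.

Lemma coef_inv : s^-1 = - 2 * (- (l / (2 * v) + 1 / (2 * s)) + l / 2 * v^-1).
Proof. by field; rewrite n2 v0 s0. Qed.

End CoefIdentities.

(** * Simple poles, the two branch points and the residues *)

Section LogarithmicPoles.
Variables (k : numClosedFieldType) (c : moduli k) (lambda1 lambda2 : k).
Local Notation t := (mod_t c).
Local Notation t' := (mod_t' c).
Local Notation iota := (const c).
Local Notation xi := (xi c).
Local Notation y := (y c).
Local Notation x := (x c).
Local Notation V := (y / xi ^+ 3).
Local Notation pE := (@E_place _ c).
Local Notation dx := (d iota x).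
Local Notation s := (iota t' - x).
Local Notation l1 := (iota lambda1).
Local Notation l2 := (iota lambda2).
Local Notation D := (nabla c lambda1 lambda2).
Local Notation matrix_aff := (matrix_aff c lambda1 lambda2).
Local Notation matrix_inf := (matrix_inf c lambda1 lambda2).

Lemma nablaD s1 s2 : D (s1 + s2) = D s1 + D s2.
Proof.
by rewrite /nabla /direct_image_connection /nabla_O dD scalerDl addrACA.
Qed.

Lemma nablaM a s1 : D (a * s1) = s1 *: d iota a + a *: D s1.
Proof.
rewrite /nabla /direct_image_connection /nabla_O dM [a *: (_ + _)]scalerDr scalerA.
by rewrite addrA [s1 *: _ + a *: _]addrC.
Qed.

Lemma half_const (a : k) : iota a / 2 = iota (a / 2).
Proof. by rewrite (fmorph_div iota) (rmorph_nat iota). Qed.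

Lemma stalk_half (P : E c) a : stalk P (iota a / 2).
Proof. by rewrite half_const; apply: (stalk_const pE). Qed.

Lemma stalk_halfN (P : E c) a : stalk P (- (iota a / 2)).
Proof. by apply: (stalkN pE); apply: stalk_half. Qed.

(** Two choices of z matter: 1 where t' - x is a unit, and x - t' at the branch points, where
    [z / s] is -1. *)
Lemma matrix_aff_regular (P : E c) z : stalk P x -> stalk P z -> stalk P (z / s) ->
  forall i j, regular_form P (z *: matrix_aff i j).
Proof.
move=> Sx Sz Szs; have n2 := two_neq0 c; have y0 := y_neq0 c.
have s0 := x_neq_const c t'; have Rw := dx_over_y_regular P.
have SM := stalkM pE; have Sh := stalk_halfN P.
apply: (mx2P (R := fun _ _ eta => regular_form P (z *: eta))).
- rewrite scalerA (coef_y l2 n2 y0) mulrA -scalerA.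
  by apply: (regularZ pE) => //; apply: (SM).
- rewrite scalerA (coef_y l1 n2 y0) mulrA -scalerA.
  by apply: (regularZ pE) => //; apply: (SM).
- rewrite scalerA (coef_sy z l1 n2 y0 s0) -scalerA.
  by apply: (regularZ pE) => //; apply: (SM).
- rewrite scalerA (coef_diag z l2 n2 y0 s0) scalerDl -scalerA.
  apply: formsD; first by apply: (regularZ pE) => //; apply: (SM).
  apply: (regularZ pE); last exact: (regular_d pE).
  by apply: (SM) => //; have := Sh 1; rewrite (rmorph1 iota).
Qed.

Lemma matrix_inf_regular i j : regular_form (Einf : E c) (matrix_inf i j).
Proof.
move: i j; have Rw := dx_over_y_regular (Einf : E c).
have SM := stalkM pE; have Sh := stalk_halfN Einf.
have VV := value_V_sqr c; have SV : stalk (Einf : E c) (V ^+ 2) by exists (-1).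
have Szy : stalk (Einf : E c) (s / y).
  rewrite mulrBl; apply: (stalkD pE).
    apply: (SM); first exact: (stalk_const pE).
    by exists 0; apply: value_inv_y.
  by apply: (stalkN pE); exists 0; apply: value_x_over_y.
apply: (mx2P (R := fun _ _ => regular_form (Einf : E c))).
- exact: (regularZ pE).
- apply: (regularZ pE) => //; rewrite -mulNr; apply: (SM) => //; exact: (SM).
- by apply: (regularZ pE) => //; rewrite -mulNr; apply: (SM).
- apply: formsD; first exact: (regularZ pE).
  apply: (regularZ pE); last exact: (regular_d pE).
  apply: (@stalkV _ _ _ _ (2 * -1)).
    apply: (placeM (pE Einf)) => //.
    by rewrite -[X in value _ X _](rmorph_nat iota); apply: (place_const (pE Einf)).
  by rewrite mulf_neq0 ?pnatr_eq0 // oppr_eq0 oner_eq0.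
Qed.

Lemma aff_neq_inf (x0 y0 : k) (h : y0 ^+ 2 = (E_rhs c).[x0]) :
  (~` [set (Einf : E c)]) (Eaff h).
Proof. by []. Qed.

Lemma regular_frame (P : E c) :
  (if P is Eaff x0 _ _ then x0 != t' else true) ->
  exists U (e : 'I_2 -> kC c) A, [/\ zopen U, U P, frame (E0 c) U e,
    connection_matrix (E c) D e A & forall i j, regular_form P (A i j)].
Proof.
case: P => [x0 y0 h xt|_].
  exists (~` [set (Einf : E c)]), (basis_1_xi c), matrix_aff; split.
  - exact: zopen_aff.
  - exact: aff_neq_inf.
  - exact: frame_aff.
  - exact: matrix_aff_connection.
  - move=> i j; rewrite -[matrix_aff i j]scale1r; apply: matrix_aff_regular.
    + by exists x0; apply: value_x.
    + exact: (stalk1 pE).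
    + rewrite mul1r; apply: (@stalkV _ _ _ _ (t' - x0)).
        exact (placeB (pE _) (place_const (pE _) t') (value_x h)).
      by rewrite subr_eq0 eq_sym.
exists (@U_inf k c), (basis_1 V), matrix_inf; split.
- exact: zopen_inf.
- by [].
- exact: frame_inf.
- exact: matrix_inf_connection.
- exact: matrix_inf_regular.
Qed.

Lemma uniformizer_ex (P : E c) : exists z, uniformizer P z.
Proof.
case: P => [x0 y0 h|]; first exact: uniformizer_aff.
by exists (x / y); apply: uniformizer_inf.
Qed.

Lemma uniformizer_stalk (P : E c) z : uniformizer P z -> stalk P z.
Proof. by case=> z0 _; exists 0. Qed.

Lemma E_rhs_t' : (E_rhs c).[t'] != 0.
Proof.
rewrite E_rhsE !mulf_neq0 ?t'_neq0 // subr_eq0 ?t'_neq1 // eq_sym.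
exact: t_neq_t'.
Qed.

Lemma branch_neq0 (x0 y0 : k) : y0 ^+ 2 = (E_rhs c).[x0] -> x0 = t' -> y0 != 0.
Proof. by move=> h e; rewrite -sqrf_eq0 h e E_rhs_t'. Qed.

Lemma logarithmic_frame (P : E c) :
  exists U (e : 'I_2 -> kC c) A, [/\ zopen U, U P, frame (E0 c) U e,
    connection_matrix (E c) D e A &
    exists2 z, uniformizer P z & forall i j, regular_form P (z *: A i j)].
Proof.
have reg : (if P is Eaff x0 _ _ then x0 != t' else true) ->
  exists U (e : 'I_2 -> kC c) A, [/\ zopen U, U P, frame (E0 c) U e,
    connection_matrix (E c) D e A &
    exists2 z, uniformizer P z & forall i j, regular_form P (z *: A i j)].
  move=> /regular_frame [U [e [A [h1 h2 h3 h4 h5]]]]; exists U, e, A; split=> //.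
  have [z hz] := uniformizer_ex P; exists z => // i j; apply: (regularZ pE) => //.
  exact: uniformizer_stalk.
case: P reg => [x0 y0 h|] reg; last exact: reg.
have [e|/reg //] := eqVneq x0 t'.
exists (~` [set (Einf : E c)]), (basis_1_xi c), matrix_aff; split.
- exact: zopen_aff.
- exact: aff_neq_inf.
- exact: frame_aff.
- exact: matrix_aff_connection.
- have u := uniformizer_x h (branch_neq0 h e).
  exists (x - iota x0) => // i j; apply: matrix_aff_regular.
  + by exists x0; apply: value_x.
  + exact: uniformizer_stalk.
  + rewrite (_ : _ / _ = -1); last by rewrite e -opprB mulNr mulfV ?x_neq_const.
    by apply: (stalkN pE); apply: (stalk1 pE).
Qed.

Lemma logarithmic_nabla : logarithmic 2 (E0 c) D.
Proof.
split=> [U Uo|P U e Uo UP fe].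
  by split=> *; [apply: nablaD|apply: nablaM].
have [W [f [A [Wo WP ff hA [z uz hz]]]]] := logarithmic_frame P.
have [B hB rB] := change_frame pE (@stalk_funfield _ c) (field_gen1 iota x y)
  (@field_genM _ _ iota x y) nablaD nablaM Wo Uo WP UP ff fe hA.
exists B => // i j; split; first exact: hB.1.
by exists z => //; apply: rB => //; apply: uniformizer_stalk.
Qed.

(** dx = - 2 xi dxi forces the value - 1 / (2 xi) at xi, and the derivative of y^2 = C_rhs(xi) then
    forces the value at y. *)
Lemma d_dx_derivation : exists dd : derivation iota, dd x = 1.
Proof.
have n2 := two_neq0 c; have y0 := y_neq0 c; have xi0 := xi_neq0 c.
have [//|dd [e _]] := @derivation_extension _ _ iota (C_rhs c) xi y (- (2 * xi)^-1)
  ((map_poly iota (C_rhs c)^`()).[xi] * (- (2 * xi)^-1) / (2 * y))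
  (@y_free _ c) (y_sqr c) (@kC_gen _ c).
  by rewrite mulrC divfK // mulf_neq0.
exists dd; rewrite der_x e mulrN opprK mulfV //; exact: mulf_neq0.
Qed.

Section Branch.
Variables (y0 : k) (h : y0 ^+ 2 = (E_rhs c).[t']).
Let P : E c := Eaff h.

(** The function y does not vanish at a branch point, so dy/dx = E_slope / (2 y) is regular there;
    the quotient rule does the rest. *)
Lemma stalk_der (dd : derivation iota) g : dd x = 1 -> stalk P g -> stalk P (dd g).
Proof.
move=> ex Sg; have y00 := branch_neq0 h erefl.
have Vy := stalkV (value_y h) y00.
have Sx : stalk P x by exists t'; apply: value_x.
have Sy : stalk P y by exists y0; apply: value_y.
have SD := stalkD pE; have SM := stalkM pE; have SC := stalk_const pE.
have nv b : b.[t', y0] != 0 -> eval2 iota b x y != 0.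
  by apply: (place_neq0 (pE P)); apply: chart_eval2.
case: Sg => r [a [b [b0 -> _]]].
apply: (@fraction_der _ _ iota dd x y (stalk P)) => //.
- by move=> f f'; apply: (SD).
- by move=> f f'; apply: (SM).
- by rewrite ex; apply: (stalk1 pE).
- rewrite (_ : dd y = E_slope (iota t) x x / 2 * y^-1).
    apply: (SM) => //; apply: (SM).
      by eexists; apply: (value_slope (value_x h) (value_x h)).
    by have := stalk_half P 1; rewrite (rmorph1 iota) mul1r.
  have := der_y dd; rewrite ex mulr1 => <-.
  exact (half_cancel (dd y) (two_neq0 c) (y_neq0 c)).
- exact: nv.
- by apply: stalkV b0; apply: chart_eval2.
Qed.

(** [xi_free] compares coefficients in k(E) only, so the contracted matrix entries have to stay in
    that field. *)
Lemma funfield_der (dd : derivation iota) g : dd x = 1 ->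
  field_gen iota x y g -> field_gen iota x y (dd g).
Proof.
have Fx := field_gen_fst iota x y; have Fy := field_gen_snd iota x y.
have FM := @field_genM _ _ iota x y; have FV := @field_genV _ _ iota x y.
have FN := @field_genN _ _ iota x y; have FD := @field_genD _ _ iota x y.
have FC := field_genC iota x y; have F1 := field_gen1 iota x y.
move=> ex [a [b [b0 ->]]].
have Fdy : field_gen iota x y (dd y).
  rewrite (half_cancel (dd y) (two_neq0 c) (y_neq0 c)) der_y ex mulr1.
  apply: (FM); last exact: (FV).
  apply: (FM); last by apply: (FV); apply: F_2.
  apply: (FD); last exact: FC.
  apply: (FD).
    by apply: (FD); [apply: (FD)|]; rewrite ?expr2; apply: (FM).
  by apply: (FN); apply: (FM); apply: (FD).
apply: fraction_der => //; first by rewrite ex.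
by apply: (FV); apply: field_gen_eval2.
Qed.

Lemma branch_pole : pole 2 (E0 c) D P.
Proof.
case=> U [e [A [Uo UP fe hA rA]]].
have [B hB rB] := change_frame pE (@stalk_funfield _ c) (field_gen1 iota x y)
  (@field_genM _ _ iota x y) nablaD nablaM Uo (zopen_aff c) UP
  (@aff_neq_inf _ _ h) fe (@frame_aff _ c) hA.
have {}rB i j : regular_form P (B i j).
  rewrite -[B i j]scale1r; apply: rB; first exact: (stalk1 pE).
  by move=> i' j'; rewrite scale1r.
have [dd ex] := d_dx_derivation.
have SB i j : stalk P (B i j dd).
  apply: (@forms_der _ _ iota dd (stalk P)) (rB i j).
  - by exists 0; apply: (place0 (pE P)).
  - by move=> a b; apply: (stalkD pE).
  - by move=> a b; apply: (stalkM pE).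
  - by move=> a; apply: stalk_der.
have FA i j : field_gen iota x y (matrix_aff i j dd).
  apply: (@forms_der _ _ iota dd (field_gen iota x y))
    ((matrix_aff_connection c lambda1 lambda2).1 i j).
  - exact: field_gen0.
  - by move=> a b; apply: field_genD.
  - by move=> a b; apply: field_genM.
  - by move=> a; apply: funfield_der.
(* Both matrices expand [nabla xi] in the basis (1, xi). Contraction with d/dx turns this equality
   of forms into a relation with coefficients in k(E). *)
have e2 : B 0 1 dd - matrix_aff 0 1 dd + (B 1 1 dd - matrix_aff 1 1 dd) * xi = 0.
  have := etrans (esym (hB.2 1)) ((matrix_aff_connection c lambda1 lambda2).2 1).
  rewrite !sum_ord2 => /(congr1 (fun eta : form iota => eta dd)) e3.
  exact: (column_identity e3).
have [_ /subr0_eq e11] :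
    B 0 1 dd - matrix_aff 0 1 dd = 0 /\ B 1 1 dd - matrix_aff 1 1 dd = 0.
  apply: xi_free e2; apply: field_genD; try (apply: field_genN; exact: FA);
    exact: (stalk_funfield (SB _ _)).
have := SB 1 1; rewrite e11 mxE /= => Ss.
have {Ss} : stalk P s^-1.
  (* The lower right entry is solved for 1/s, all its other terms being regular. It has its pole for
     all values of the parameters, whereas the lower left entry vanishes when [lambda1] is 0. *)
  rewrite (coef_inv l2 (two_neq0 c) (y_neq0 c) (x_neq_const c t')).
  apply: (stalkM pE).
    by rewrite -(rmorph_nat iota) -(rmorphN iota); apply: (stalk_const pE).
  apply: (stalkD pE).
    by move: Ss; rewrite -[X in stalk P X]/(_ * dd x) ex mulr1.
  apply: (stalkM pE); first exact: stalk_half.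
  by apply: (stalkV (value_y h)); apply: branch_neq0 h erefl.
case=> r hr.
(* s vanishes at the point, so a regular 1/s would give s * s^-1 = 1 the value 0. *)
have hz := placeM (pE P) (placeB (pE P) (place_const (pE P) t') (value_x h)) hr.
rewrite mulfV ?x_neq_const // subrr mul0r in hz.
by have := place_fun (pE P) hz (place1 (pE P)) => /esym/eqP; rewrite oner_eq0.
Qed.

(** Here [y0] is either square root, so one computation covers both branch points. *)
Lemma branch_residue i j : has_residue P (matrix_aff i j)
  (mx2 0 0 (lambda1 / (2 * y0)) (1 / 2) i j).
Proof.
have y00 := branch_neq0 h erefl; have u := uniformizer_x h y00.
have n2 := two_neq0 c; have yn0 := y_neq0 c; have s0 := x_neq_const c t'.
have Rw := dx_over_y_regular P.
have dz : d iota (x - iota t') = dx by rewrite dD dN dC subr0.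
have res0 (eta : form iota) : regular_form P eta -> has_residue P eta 0.
  move=> re; exists (x - iota t'), eta; split=> //.
  by rewrite (rmorph0 iota) mul0r scale0r add0r.
have zE : x - iota t' = - s by rewrite opprB.
have Ry l : regular_form P (- (iota l / (2 * y)) *: dx).
  by rewrite (coef_y _ n2 yn0) -scalerA; apply: (regularZ pE) => //; apply: stalk_halfN.
rewrite /matrix_aff !mxE; move: i j; apply: ord2P; apply: ord2P => /=.
- by apply: res0; apply: Ry.
- by apply: res0; apply: Ry.
- have [g Sg yg] : exists2 g, stalk P g & y - iota y0 = g * (x - iota t').
    apply: u.2; rewrite -(subrr y0).
    exact (placeB (pE _) (value_y h) (place_const (pE _) y0)).
  have iy0 : iota y0 != 0 by rewrite (fmorph_eq0 iota).
  rewrite zE in yg.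
  rewrite (coef_res l1 n2 yn0 s0 iy0 yg) -zE scalerDl -dz.
  exists (x - iota t'), 
      (- (l1 / 2 * g / (y * iota y0)) *: d iota (x - iota t')); split=> //.
    rewrite dz; apply: (regularZ pE).
      apply: (stalkN pE); apply: (stalkM pE).
        by apply: (stalkM pE) => //; apply: stalk_half.
      apply: (@stalkV _ _ _ _ (y0 * y0)); last by rewrite mulf_neq0.
      exact (placeM (pE _) (value_y h) (place_const (pE _) y0)).
    by apply: (regular_d pE); exists t'; apply: value_x.
  by rewrite (fmorph_div iota) (rmorphM iota) (rmorph_nat iota).
- exists (x - iota t'), (- (l2 / (2 * y)) *: dx); split=> //.
  rewrite (coef_res_diag l2 n2 yn0 s0) -zE scalerDl dz.
  by rewrite (fmorph_div iota) (rmorph1 iota) (rmorph_nat iota).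
Qed.
End Branch.

Lemma pole_branch (P : E c) : pole 2 (E0 c) D P ->
  exists y0 (h : y0 ^+ 2 = (E_rhs c).[t']), P = Eaff h.
Proof.
move=> pP; case: P pP => [x0 y0 h|] pP.
  have [e|n] := eqVneq x0 t'; first by subst x0; exists y0, h.
  by case: pP; apply: regular_frame.
by case: pP; apply: regular_frame.
Qed.
End LogarithmicPoles.

Theorem proposition6 (R : realType) (t t' : complex R)
    (ht0 : t != 0) (ht1 : t != 1) (ht'0 : t' != 0) (ht'1 : t' != 1)
    (htt' : t != t') (lambda1 lambda2 : complex R)
    (y0 : complex R) (hy0 : y0 ^+ 2 = t' * (t' - 1) * (t' - t)) :
  let c := Moduli ht0 ht1 ht'0 ht'1 htt' in
  let D := nabla c lambda1 lambda2 in
  let p1 : E c := p_plus (c:=c) hy0 in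
  let p2 : E c := p_minus (c:=c) hy0 in
  let x := x c in
  let y := y c in
  let t'_ := const c t' in
  let l1 := const c lambda1 in
  let l2 := const c lambda2 in
  let dx := d (const c) x in
  let A := mx2
    (- (l2 / (2 * y)) *: dx)               (- (l1 / (2 * y)) *: dx)
    (- (l1 / (2 * (t'_ - x) * y)) *: dx)
                        (- (l2 / (2 * y) + 1 / (2 * (t'_ - x))) *: dx) in
  [/\ vector_bundle 2 (E0 c),
      logarithmic 2 (E0 c) D,
      forall P : E c, pole 2 (E0 c) D P <-> P = p1 \/ P = p2,
      frame (E0 c) (~` [set (Einf : E c)]) (basis_1_xi c) /\
        connection_matrix (E c) D (basis_1_xi c) A
    & (forall i j, has_residue p1 (A i j)
         (mx2 0 0 (lambda1 / (2 * y0)) (1 / 2) i j)) /\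
      (forall i j, has_residue p2 (A i j)
         (mx2 0 0 (- (lambda1 / (2 * y0))) (1 / 2) i j))].
Proof.
move=> c D p1 p2 x y t'_ l1 l2 dx A.
have pole_p (y1 : complex R) (h : y1 ^+ 2 = (E_rhs c).[t']) : pole 2 (E0 c) D (Eaff h).
  exact: branch_pole.
have res_p (y1 : complex R) (h : y1 ^+ 2 = (E_rhs c).[t']) i j :
    has_residue (Eaff h : E c) (A i j) (mx2 0 0 (lambda1 / (2 * y1)) (1 / 2) i j).
  exact: branch_residue.
split.
- exact: vector_bundle_E0.
- exact: logarithmic_nabla.
- move=> P; split=> [/pole_branch[y1 [h ->]]|[]->]; last 2 first.
  + exact: pole_p.
  + exact: pole_p.
  have /eqP : y1 ^+ 2 = y0 ^+ 2 by rewrite h; apply/esym/branch_subproof.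
  by rewrite eqf_sqr => /orP[]/eqP e; [left|right]; apply: Eaff_eq.
- by split; [exact: frame_aff|exact: matrix_aff_connection].
- split=> i j; first exact: res_p.
  (* The residue at the second branch point is the same formula with - y0 in place of y0. *)
  by rewrite -mulrN -invrN -mulrN; apply: res_p.
Qed.
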